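(* Let $\mathfrak g_3=(0,-e^{13},e^{12},0,-e^{46},-e^{45})$. Up to isomorphism, the complex structures on $\mathfrak g_3$ with non-zero closed $(3,0)$-form are the structures $J_x$, $x\in\mathbb R$, $x>0$, determined by a $(1,0)$-basis $\{\omega^1,\omega^2,\omega^3\}$ with structure equations $$ \begin{aligned} d\omega^1&=0,\\ d\omega^2&=-\tfrac12\omega^{13}-\left(\tfrac12+xi\right)\omega^{1\bar3}+xi\,\omega^{3\bar1},\\ d\omega^3&=\tfrac12\omega^{12}+\left(\tfrac12-\tfrac{i}{4x}\right)\omega^{1\bar2}+\tfrac{i}{4x}\,\omega^{2\bar1}. \end{aligned} $$
   Context: The notation $(\epsilon_1,\dots,\epsilon_6)$ denotes the real Lie algebra whose dual has a basis $\{e^1,\dots,e^6\}$ with $de^i=\epsilon_i$ ($d$ the Chevalley–Eilenberg differential, $e^{ij}=e^i\wedge e^j$). A complex structure on $\mathfrak g$ is an endomorphism $J$ with $J^2=-I$ and vanishing Nijenhuis tensor; a complex $1$-form $\eta$ is of type $(1,0)$ if $\eta\circ J=i\eta$. Two complex structures $J,J'$ on $\mathfrak g$ are isomorphic (equivalent) if there is an automorphism $F$ of $\mathfrak g$ with $F\circ J=J'\circ F$. Write $\omega^{jk}=\omega^j\wedge\omega^k$ and $\omega^{j\bar k}=\omega^j\wedge\overline{\omega^k}$. *)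

(* Defs.v *)
From mathcomp Require Import all_boot all_order all_algebra.
From mathcomp Require Import reals.
From mathcomp Require Export complex.
From mathcomp Require Import ring.
Set Implicit Arguments.
Unset Strict Implicit.
Unset Printing Implicit Defensive.
Import GRing.Theory.
Local Open Scope ring_scope.
Local Open Scope complex_scope.

(** Forms on a vector space V are functions of their arguments, with values in
    R (real forms) or R[i] (complex forms).  The wedge product is normalized by
    (a /\ b)(X, Y) = a(X) b(Y) - a(Y) b(X). *)

Section Wedge.
Variables (V : Type) (A : pzRingType).
Implicit Types (a b c : V -> A).

Definition wedge2 a b (X Y : V) : A := a X * b Y - a Y * b X.

Definition wedge3 a b c (X Y Z : V) : A :=
  a X * wedge2 b c Y Z - a Y * wedge2 b c X Z + a Z * wedge2 b c X Y.

End Wedge.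

Definition conj_form (R : pzRingType) (V : Type) (a : V -> R[i]) : V -> R[i] :=
  fun X => (a X)^*.

Section LieAlgebra.
Variables (R : realType) (V : vectType R) (br : V -> V -> V).

Definition is_lie_bracket : Prop :=
  [/\ forall (a : R) X Y Z, br (a *: X + Y) Z = a *: br X Z + br Y Z,
      forall (a : R) X Y Z, br Z (a *: X + Y) = a *: br Z X + br Z Y,
      forall X, br X X = 0
    & forall X Y Z, br X (br Y Z) + br Y (br Z X) + br Z (br X Y) = 0].

(** Chevalley-Eilenberg differential, in degrees 1 and 3:
    (d a)(X_0, .., X_k)
      = \sum_(i < j) (-1)^(i+j) a([X_i, X_j], X_0, .. (omit i, j) .., X_k). *)

Definition d1 (A : zmodType) (a : V -> A) (X Y : V) : A := - a (br X Y).

Definition d3 (A : zmodType) (a : V -> V -> V -> A) (X Y Z W : V) : A :=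
  - a (br X Y) Z W + a (br X Z) Y W - a (br X W) Y Z
  - a (br Y Z) X W + a (br Y W) X Z - a (br Z W) X Y.

Definition nijenhuis (J : 'End(V)) (X Y : V) : V :=
  br (J X) (J Y) - J (br (J X) Y) - J (br X (J Y)) - br X Y.

Definition complex_structure (J : 'End(V)) : Prop :=
  (forall X, J (J X) = - X) /\ (forall X Y, nijenhuis J X Y = 0).

Definition lie_automorphism (F : 'End(V)) : Prop :=
  bijective F /\ (forall X Y, F (br X Y) = br (F X) (F Y)).

Definition isomorphic_structures (J J' : 'End(V)) : Prop :=
  exists2 F : 'End(V), lie_automorphism F & forall X, F (J X) = J' (F X).

Definition complex_1form (a : V -> R[i]) : Prop :=
  forall (r : R) X Y, a (r *: X + Y) = r%:C * a X + a Y.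

Definition form10 (J : 'End(V)) (a : V -> R[i]) : Prop :=
  complex_1form a /\ (forall X, a (J X) = 'i * a X).

Definition basis10 (J : 'End(V)) (n : nat) (w : 'I_n -> V -> R[i]) : Prop :=
  [/\ forall j, form10 J (w j),
      forall c : 'I_n -> R[i],
        (forall X, \sum_j c j * w j X = 0) -> forall j, c j = 0
    & forall a, form10 J a ->
        exists c : 'I_n -> R[i], forall X, a X = \sum_j c j * w j X].

(** The (3,0)-forms are the third exterior power of the (1,0)-forms: finite sums
    of wedge products of three (1,0)-forms (scalars go into the factors). *)
Definition form30 (J : 'End(V)) (P : V -> V -> V -> R[i]) : Prop :=
  exists (n : nat) (a b c : 'I_n -> V -> R[i]),
    (forall k, [/\ form10 J (a k), form10 J (b k) & form10 J (c k)]) /\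
    (forall X Y Z, P X Y Z = \sum_k wedge3 (a k) (b k) (c k) X Y Z).

Definition has_closed_nonzero_form30 (J : 'End(V)) : Prop :=
  exists P : V -> V -> V -> R[i],
    [/\ form30 J P,
        exists X Y Z, P X Y Z != 0
      & forall X Y Z W, d3 P X Y Z W = 0].

End LieAlgebra.

(** The Lie algebra g_3 = (0, -e^13, e^12, 0, -e^46, -e^45) is realized on R^6,
    with e^1, .., e^6 the coordinate forms; since (d e^k)(X, Y) = - e^k([X, Y]),
    the k-th coordinate of [X, Y] is - (d e^k)(X, Y). *)

Section G3.
Variable R : realType.

Definition e (k : nat) (X : 'rV[R]_6) : R := X 0 (inord k.-1).

Definition e2 (j k : nat) : 'rV[R]_6 -> 'rV[R]_6 -> R := wedge2 (e j) (e k).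

Definition g3_de (k : nat) (X Y : 'rV[R]_6) : R :=
  match k with
  | 2 => - e2 1 3 X Y
  | 3 => e2 1 2 X Y
  | 5 => - e2 4 6 X Y
  | 6 => - e2 4 5 X Y
  | _ => 0
  end.

Definition g3_bracket (X Y : 'rV[R]_6) : 'rV[R]_6 := \row_(k < 6) - g3_de k.+1 X Y.

Lemma d_e (k : nat) (X Y : 'rV[R]_6) : (1 <= k <= 6)%N ->
  d1 g3_bracket (e k) X Y = g3_de k X Y.
Proof.
case: k => // k /= lek.
by rewrite /d1 {1}/e mxE inordK ?opprK.
Qed.

Lemma g3_lie : is_lie_bracket g3_bracket.
Proof.
have eB k X Y : (0 < k <= 6)%N -> e k (g3_bracket X Y) = - g3_de k X Y.
  by move=> /d_e <-; rewrite opprK.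
have eL k a X Y : e k (a *: X + Y) = a * e k X + e k Y by rewrite /e !mxE.
split.
- move=> a X Y Z; apply/rowP => k; rewrite !mxE.
  by case: k => -[|[|[|[|[|[|k]]]]]] //= _; rewrite /e2 /wedge2 ?eL; ring.
- move=> a X Y Z; apply/rowP => k; rewrite !mxE.
  by case: k => -[|[|[|[|[|[|k]]]]]] //= _; rewrite /e2 /wedge2 ?eL; ring.
- move=> X; apply/rowP => k; rewrite !mxE.
  by case: k => -[|[|[|[|[|[|k]]]]]] //= _; rewrite /e2 /wedge2; ring.
- move=> X Y Z; apply/rowP => k; rewrite !mxE.
  by case: k => -[|[|[|[|[|[|k]]]]]] //= _; rewrite /e2 /wedge2 ?eB //= /e2 /wedge2; ring.
Qed.

(** [J_x]: the structure equations of the parameter x hold in some (1,0)-basis of J. *)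
Definition g3_structure (x : R) (J : 'End('rV[R]_6)) : Prop :=
  complex_structure g3_bracket J /\
  exists w1 w2 w3 : 'rV[R]_6 -> R[i],
    let w1b := conj_form w1 in
    let w2b := conj_form w2 in
    let w3b := conj_form w3 in
    [/\ basis10 J (fun j : 'I_3 => nth w1 [:: w1; w2; w3] j),
        forall X Y, d1 g3_bracket w1 X Y = 0,
        forall X Y, d1 g3_bracket w2 X Y =
          - (1 / 2) * wedge2 w1 w3 X Y
          - (1 / 2 + x%:C * 'i) * wedge2 w1 w3b X Y
          + x%:C * 'i * wedge2 w3 w1b X Y
      & forall X Y, d1 g3_bracket w3 X Y =
          1 / 2 * wedge2 w1 w2 X Y
          + (1 / 2 - 'i / (4 * x%:C)) * wedge2 w1 w2b X Y
          + 'i / (4 * x%:C) * wedge2 w2 w1b X Y].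

End G3.

(* Main.v *)
From HB Require Import structures.
Require Import Defs.
From mathcomp Require Import all_boot all_order all_algebra.
From mathcomp Require Import reals.
From mathcomp Require Import ring lra.
Set Implicit Arguments.
Unset Strict Implicit.
Unset Printing Implicit Defensive.
Import Order.TTheory GRing.Theory Num.Theory.
Local Open Scope complex_scope.
Local Open Scope ring_scope.

(** Write n for the span of the basis vectors e_2, e_3, e_5, e_6 dual to the
    coordinate forms: it is an abelian ideal, on which ad(e_1) rotates the
    plane <e_2, e_3> and kills <e_5, e_6>, while ad(e_4) swaps e_5 and e_6 and
    kills <e_2, e_3>.

    Classification.  If the (3,0)-form P is closed, contracting dP with X and
    with JX shows that the complex trace of the C-linear operator
    ad(X) + J ad(JX) vanishes; g_3 being unimodular, this says that
    tr(J ad(Y)) = 0 for all Y (closed_form30_trace).  On g_3 this is a short list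
    of linear conditions on the matrix of J; together with the Nijenhuis
    equations they force J n = n, J e_1 = +- e_4 modulo n, and the block of J on
    <e_2, e_3> to be a symmetric matrix of determinant -1
    (complex_structure_coords).  A rotation of <e_2, e_3> diagonalizes the block,
    with eigenvalues la < 0 and -1/la (sym_det_N1_diag), and in the rotated
    coordinates the (1,0)-forms with real parts e^1, f^2 + const e^1,
    f^3 + const e^1 satisfy the structure equations with x = -la/2
    (g3_frame_intro).  The constants are chosen so that the last two forms
    vanish on a vector A with A = e_1 modulo n and [A, JA] = 0.

    Existence.  The criterion g3_frame_intro applies to an explicit J of this
    shape, and the structure equations contain no (0,2)-component, which is
    integrability (g3_frame_complex_structure).

    Uniqueness of J_x.  A (1,0)-basis identifies the real vector space with C^3.
    Matching two bases with the same structure equations gives an isomorphism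
    (g3_frame_isomorphic).  The product of the three basic forms is closed because
    every term of dw^2 contains w^1 or w^3 and every term of dw^3 contains w^1 or
    w^2 (g3_frame_closed_form30).

    Moduli.  After pulling back along an isomorphism, one J has two bases, with
    parameters x and x'.  The closed (1,0)-forms are the multiples of w^1, and
    comparing the w^1 /\ w^k and conj(w^1) /\ w^k components of the structure
    equations leaves x = x' or 4 x x' = -1 (g3_frame_parameter_unique). *)

Local Notation Re := (@complex.Re _).
Local Notation Im := (@complex.Im _).

(** * Real-linear maps and frames of (1,0)-forms *)

Section LinearMaps.
Variables (R : fieldType) (U W : vectType R).

Lemma linear_lfun (g : U -> W) : linear g ->
  exists f : 'Hom(U, W), forall X, f X = g X.
Proof.
move=> lin_g.
pose h : {linear U -> W} := HB.pack g (GRing.isLinear.Build _ _ _ _ g lin_g).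
by exists (linfun h) => X; rewrite lfunE.
Qed.

Lemma linear_inj_surj (g : U -> W) : linear g -> \dim {:U} = \dim {:W} ->
  (forall X, g X = 0 -> X = 0) -> forall Y, exists X, g X = Y.
Proof.
move=> /linear_lfun [f fE] eq_dim inj_g Y.
have kf : lker f = 0%VS.
  apply/eqP; rewrite -subv0; apply/subvP => X.
  by rewrite memv_ker fE memv0 => /eqP /inj_g ->.
have : Y \in limg f.
  suff -> : limg f = fullv by rewrite memvf.
  apply/eqP; rewrite eqEdim subvf -eq_dim /=.
  by rewrite limg_dim_eq // kf capv0.
by case/memv_imgP => X _ ->; exists X.
Qed.

End LinearMaps.

Section Frames.
Variable R : realType.
Local Notation V := 'rV[R]_6.
Implicit Types (J : 'End(V)) (w : 'I_3 -> V -> R[i]).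

Lemma complex_parts (z : R[i]) : z = (Re z)%:C + 'i * (Im z)%:C.
Proof. exact: complexE. Qed.

Lemma complex_1formD (a : V -> R[i]) X Y : complex_1form a ->
  a (X + Y) = a X + a Y.
Proof. by move=> lin_a; rewrite -[X]scale1r lin_a scale1r mul1r. Qed.

Lemma complex_1form0 (a : V -> R[i]) : complex_1form a -> a 0 = 0.
Proof.
by move=> lin_a; apply: (addrI (a 0)); rewrite -complex_1formD // !addr0.
Qed.

Lemma complex_1formZ (a : V -> R[i]) r X : complex_1form a ->
  a (r *: X) = r%:C * a X.
Proof.
by move=> lin_a; rewrite -[r *: X]addr0 lin_a complex_1form0 // addr0.
Qed.

Lemma complex_1formN (a : V -> R[i]) X : complex_1form a -> a (- X) = - a X.
Proof.
move=> lin_a; rewrite -scaleN1r complex_1formZ //.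
by rewrite rmorphN rmorph1 mulN1r.
Qed.

Lemma complex_1form_sum (a : V -> R[i]) (I : finType) (F : I -> V) :
  complex_1form a -> a (\sum_i F i) = \sum_i a (F i).
Proof.
move=> lin_a; apply: (big_morph a); first by move=> X Y; exact: complex_1formD.
exact: complex_1form0.
Qed.

(** The combination with complex coefficients z_j of the vectors E_j, for the
    complex vector space structure on V in which i acts as J. *)
Definition ccomb J (E : 'I_3 -> V) (z : 'I_3 -> R[i]) : V :=
  \sum_j (Re (z j) *: E j + Im (z j) *: J (E j)).

Lemma form10_ccomb J a E z : form10 J a ->
  a (ccomb J E z) = \sum_j z j * a (E j).
Proof.
case=> lin_a aJ; rewrite complex_1form_sum //; apply: eq_bigr => j _.
rewrite lin_a complex_1formZ // aJ [in RHS](complex_parts (z j)).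
by rewrite mulrDl mulrA [_%:C * 'i]mulrC.
Qed.

Lemma ReZD (r : R) (z z' : R[i]) : Re (r%:C * z + z') = r * Re z + Re z'.
Proof. by case: z z' => [a b] [c d] /=; rewrite mul0r subr0. Qed.

Lemma ImZD (r : R) (z z' : R[i]) : Im (r%:C * z + z') = r * Im z + Im z'.
Proof. by case: z z' => [a b] [c d] /=; rewrite mul0r addr0. Qed.

Lemma complex_ext (z z' : R[i]) : Re z = Re z' -> Im z = Im z' -> z = z'.
Proof. by case: z z' => [a b] [c d] /= -> ->. Qed.

Definition dual_frame w (E : 'I_3 -> V) :=
  forall k j, w k (E j) = (k == j)%:R.

Lemma dual_frame_ccomb J w E z k : (forall j, form10 J (w j)) ->
  dual_frame w E -> w k (ccomb J E z) = z k.
Proof.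
move=> w10 dual; rewrite form10_ccomb // (bigD1 k) //= dual eqxx mulr1.
rewrite big1 ?addr0 // => j neq_jk.
by rewrite dual eq_sym (negPf neq_jk) mulr0.
Qed.

(** Three (1,0)-forms without common zero map V injectively, hence by dimension
    isomorphically, to C^3; E is the preimage of the standard basis. *)
Lemma dual_frame_exists J w : (forall j, form10 J (w j)) ->
  (forall X, (forall j, w j X = 0) -> X = 0) -> exists E, dual_frame w E.
Proof.
move=> w10 inj_w.
pose g (X : V) : 'M[R]_(3, 2) :=
  \matrix_(j, b) if b == 0 then Re (w j X) else Im (w j X).
have lin_g : linear g.
  move=> r X Y; apply/matrixP => j b; rewrite !mxE (w10 j).1.
  by case: (b == 0); rewrite ?ReZD ?ImZD.
have /(linear_inj_surj lin_g) surj_g : \dim {:V} = \dim {:'M[R]_(3, 2)}.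
  by rewrite !dimvf /dim /=.
have inj_g X : g X = 0 -> X = 0.
  move=> /matrixP gX0; apply: inj_w => j; apply: complex_ext.
    by have := gX0 j 0; rewrite !mxE.
  by have := gX0 j 1; rewrite !mxE.
pose m k : 'M[R]_(3, 2) := \matrix_(j, b) ((j == k) && (b == 0))%:R.
have exE k : exists X, g X == m k.
  by have [X gX] := surj_g inj_g (m k); exists X; rewrite gX.
exists (fun k => xchoose (exE k)) => k j.
have /eqP /matrixP gE := xchooseP (exE j).
apply: complex_ext.
  have := gE k 0; rewrite !mxE /= andbT => ->.
  by case: (k == j).
have := gE k 1; rewrite !mxE /= andbF => ->.
by case: (k == j).
Qed.

(** The complex combinations of a dual frame are a real subspace of dimension
    6, so they exhaust V, and the forms read off the coefficients. *)
Lemma ccomb_dual_frame J w E X : (forall j, form10 J (w j)) ->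
  dual_frame w E -> X = ccomb J E (fun j => w j X).
Proof.
move=> w10 dual.
pose g (m : 'M[R]_(3, 2)) := ccomb J E (fun j => m j 0 +i* m j 1).
have lin_g : linear g.
  move=> r m m'; rewrite /g /ccomb scaler_sumr -big_split /=.
  apply: eq_bigr => j _; rewrite !mxE !scalerDl !scalerDr !scalerA.
  by rewrite addrACA.
have /(linear_inj_surj lin_g) surj_g : \dim {:'M[R]_(3, 2)} = \dim {:V}.
  by rewrite !dimvf /dim /=.
have wg m k : w k (g m) = m k 0 +i* m k 1 by apply: dual_frame_ccomb.
have inj_g m : g m = 0 -> m = 0.
  move=> gm0; apply/matrixP => k b.
  have := wg m k; rewrite gm0 (complex_1form0 (w10 k).1) mxE.
  have [-> | ->] : b = 0 \/ b = 1.
    by case: b => -[|[|b]] // ltb; [left | right]; apply: val_inj.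
    by case.
  by case.
have [m <-] := surj_g inj_g X.
by apply: eq_bigr => j _; rewrite wg.
Qed.

(** On a dual frame a (1,0)-form is determined by its three values, so linear
    independence and spanning both reduce to the absence of a common zero. *)
Lemma basis10_intro J w : (forall j, form10 J (w j)) ->
  (forall X, (forall j, w j X = 0) -> X = 0) -> basis10 J w.
Proof.
move=> w10 inj_w; have [E dual] := dual_frame_exists w10 inj_w.
split=> // [c c0 j | a a10].
  have := c0 (E j); rewrite (bigD1 j) //= dual eqxx mulr1 big1 ?addr0 //.
  by move=> k neq_kj; rewrite dual (negPf neq_kj) mulr0.
exists (fun j => a (E j)) => X.
rewrite [in LHS](ccomb_dual_frame X w10 dual) form10_ccomb //.
by apply: eq_bigr => j _; rewrite mulrC.
Qed.

End Frames.

(** * The structure equations: uniqueness and the closed (3,0)-form *)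

Section FormsOfTypeOneZero.
Variable R : realType.
Local Notation V := 'rV[R]_6.
Implicit Types (J : 'End(V)) (w : 'I_3 -> V -> R[i]).

Lemma e_lin k (a : R) X Y : e k (a *: X + Y) = a * e k X + e k Y.
Proof. by rewrite /e !mxE. Qed.

Lemma coordP (X Y : V) : e 1 X = e 1 Y -> e 2 X = e 2 Y -> e 3 X = e 3 Y ->
  e 4 X = e 4 Y -> e 5 X = e 5 Y -> e 6 X = e 6 Y -> X = Y.
Proof.
move=> eq1 eq2 eq3 eq4 eq5 eq6; apply/rowP => k.
have -> : k = inord (nat_of_ord k) by rewrite inord_val.
by case: k => -[|[|[|[|[|[|k]]]]]].
Qed.

Lemma real_part_form10 J (xi : V -> R) : (forall X, J (J X) = - X) ->
  (forall (a : R) X Y, xi (a *: X + Y) = a * xi X + xi Y) ->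
  form10 J (fun X => xi X -i* xi (J X)).
Proof.
move=> JJ lin_xi; split=> [a X Y | X].
  by rewrite linearP !lin_xi; apply: complex_ext => /=; ring.
have xi0 : xi 0 = 0.
  by have := lin_xi (-1) 0 0; rewrite scaler0 addr0 mulN1r addNr.
have -> : xi (J (J X)) = - xi X.
  by rewrite JJ -scaleN1r -[_ *: X]addr0 lin_xi xi0 addr0 mulN1r.
by apply: complex_ext => /=; ring.
Qed.

(** Every real form is the real part of a (1,0)-form, so the common zeros of
    a (1,0)-basis are killed by all the coordinates. *)
Lemma basis10_inj J w X : (forall X, J (J X) = - X) -> basis10 J w ->
  (forall j, w j X = 0) -> X = 0.
Proof.
move=> JJ [_ _ span_w] wX0.
have eX0 k : e k X = 0.
  have [c cE] := span_w _ (real_part_form10 JJ (e_lin k)).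
  have := cE X; rewrite big1 => [[]//| j _]; by rewrite wX0 mulr0.
by apply: coordP; rewrite eX0 /e mxE.
Qed.

End FormsOfTypeOneZero.

Section StructureEquations.
Variable R : realType.
Local Notation V := 'rV[R]_6.
Local Notation br := (@g3_bracket R).
Implicit Types (J : 'End(V)) (x : R).

(** Written so as to be convertible to the family used in [g3_structure]. *)
Definition triple (w1 w2 w3 : V -> R[i]) (j : 'I_3) : V -> R[i] :=
  nth w1 [:: w1; w2; w3] j.

Lemma forall_I3 (P : 'I_3 -> Prop) : P 0 -> P 1 -> P 2%:R -> forall j, P j.
Proof.
move=> P0 P1 P2; case=> -[|[|[|j]]] // ltj.
- by have -> : Ordinal ltj = 0 by apply: val_inj.
- by have -> : Ordinal ltj = 1 by apply: val_inj.
- by have -> : Ordinal ltj = 2%:R by apply: val_inj.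
Qed.

Lemma sum_I3 (T : nmodType) (F : 'I_3 -> T) : \sum_j F j = F 0 + F 1 + F 2%:R.
Proof.
rewrite !big_ord_recl big_ord0 addr0 addrA.
congr (F _ + F _ + F _); exact: val_inj.
Qed.

Definition dw2 x (w1 w3 : V -> R[i]) X Y : R[i] :=
  - (1 / 2) * wedge2 w1 w3 X Y
  - (1 / 2 + x%:C * 'i) * wedge2 w1 (conj_form w3) X Y
  + x%:C * 'i * wedge2 w3 (conj_form w1) X Y.

Definition dw3 x (w1 w2 : V -> R[i]) X Y : R[i] :=
  1 / 2 * wedge2 w1 w2 X Y
  + (1 / 2 - 'i / (4 * x%:C)) * wedge2 w1 (conj_form w2) X Y
  + 'i / (4 * x%:C) * wedge2 w2 (conj_form w1) X Y.

Definition g3_frame x J (w1 w2 w3 : V -> R[i]) : Prop :=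
  [/\ basis10 J (triple w1 w2 w3),
      forall X Y, w1 (br X Y) = 0,
      forall X Y, w2 (br X Y) = - dw2 x w1 w3 X Y
    & forall X Y, w3 (br X Y) = - dw3 x w1 w2 X Y].

Lemma g3_structureP x J : g3_structure x J <->
  complex_structure br J /\ exists w1 w2 w3, g3_frame x J w1 w2 w3.
Proof.
split=> -[cJ [w1 [w2 [w3 [b w1E w2E w3E]]]]]; split=> //; exists w1, w2, w3.
  split=> // X Y.
  - by apply/eqP; rewrite -oppr_eq0; apply/eqP; exact: w1E.
  - by rewrite /dw2 -w2E opprK.
  - by rewrite /dw3 -w3E opprK.
split=> // X Y.
- by rewrite /d1 w1E oppr0.
- by rewrite /d1 w2E opprK.
- by rewrite /d1 w3E opprK.
Qed.

Lemma dw2_comp (F : V -> V) x (a a' b b' : V -> R[i]) X Y :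
  (forall X, a' (F X) = a X) -> (forall X, b' (F X) = b X) ->
  dw2 x a' b' (F X) (F Y) = dw2 x a b X Y.
Proof. by move=> aE bE; rewrite /dw2 /wedge2 /conj_form !aE !bE. Qed.

Lemma dw3_comp (F : V -> V) x (a a' b b' : V -> R[i]) X Y :
  (forall X, a' (F X) = a X) -> (forall X, b' (F X) = b X) ->
  dw3 x a' b' (F X) (F Y) = dw3 x a b X Y.
Proof. by move=> aE bE; rewrite /dw3 /wedge2 /conj_form !aE !bE. Qed.

(** The structure equations determine the bracket in terms of the basis, so the
    linear map matching the two bases preserves brackets; it commutes with the
    complex structures because both bases are of type (1,0). *)
Lemma g3_frame_isomorphic x J J' w1 w2 w3 w1' w2' w3' :
  (forall X, J (J X) = - X) -> (forall X, J' (J' X) = - X) ->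
  g3_frame x J w1 w2 w3 -> g3_frame x J' w1' w2' w3' ->
  isomorphic_structures br J J'.
Proof.
move=> JJ JJ' [bw w1E w2E w3E] [bw' w1E' w2E' w3E'].
set w := triple w1 w2 w3 in bw; set w' := triple w1' w2' w3' in bw'.
have inj_w X := @basis10_inj _ J w X JJ bw.
have inj_w' X := @basis10_inj _ J' w' X JJ' bw'.
have [w10 _ _] := bw; have [w10' _ _] := bw'.
have [E dualE] := dual_frame_exists w10 inj_w.
have [E' dualE'] := dual_frame_exists w10' inj_w'.
have eq_w X Y : (forall j, w j X = w j Y) -> X = Y.
  move=> eqXY; apply/eqP; rewrite -subr_eq0; apply/eqP; apply: inj_w => j.
  by rewrite complex_1formD ?complex_1formN ?eqXY ?subrr //; case: (w10 j).
have eq_w' X Y : (forall j, w' j X = w' j Y) -> X = Y.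
  move=> eqXY; apply/eqP; rewrite -subr_eq0; apply/eqP; apply: inj_w' => j.
  by rewrite complex_1formD ?complex_1formN ?eqXY ?subrr //; case: (w10' j).
pose f X := ccomb J' E' (fun j => w j X).
have w'f j X : w' j (f X) = w j X by apply: dual_frame_ccomb.
have lin_f : linear f.
  by move=> a X Y; apply: eq_w' => j; rewrite w'f (w10 j).1 (w10' j).1 !w'f.
have [F FE] := linear_lfun lin_f.
have w'F j X : w' j (F X) = w j X by rewrite FE.
have w1F X : w1' (F X) = w1 X := w'F 0 X.
have w2F X : w2' (F X) = w2 X := w'F 1 X.
have w3F X : w3' (F X) = w3 X := w'F 2%:R X.
exists F; last first.
  by move=> X; apply: eq_w' => j; rewrite w'F (w10 j).2 (w10' j).2 w'F.
split.
  exists (fun X => ccomb J E (fun j => w' j X)) => X.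
    by apply: eq_w => j; rewrite (dual_frame_ccomb (J := J)).
  by apply: eq_w' => j; rewrite w'F (dual_frame_ccomb (J := J)).
move=> X Y; apply: eq_w'; apply: forall_I3; rewrite w'F /w /w' /triple /=.
- by rewrite w1E w1E'.
- by rewrite w2E w2E' (dw2_comp _ _ _ w1F w3F).
- by rewrite w3E w3E' (dw3_comp _ _ _ w1F w2F).
Qed.

Lemma g3_frame_closed_form30 x J w1 w2 w3 : (forall X, J (J X) = - X) ->
  g3_frame x J w1 w2 w3 -> has_closed_nonzero_form30 br J.
Proof.
move=> JJ [bw w1E w2E w3E].
have [w10 _ _] := bw.
have [E dual] := dual_frame_exists w10 (fun X => @basis10_inj _ J _ X JJ bw).
exists (wedge3 w1 w2 w3); split.
- exists 1, (fun _ => w1), (fun _ => w2), (fun _ => w3); split=> [k | X Y Z].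
    by split; [exact: (w10 0) | exact: (w10 1) | exact: (w10 2%:R)].
  by rewrite big_ord1.
- exists (E 0), (E 1), (E 2%:R).
  have dualE k j : triple w1 w2 w3 k (E j) = (k == j)%:R := dual k j.
  have := dualE 0; rewrite /triple /= => E1.
  have := dualE 1; rewrite /triple /= => E2.
  have := dualE 2%:R; rewrite /triple /= => E3.
  by rewrite /wedge3 /wedge2 !E1 !E2 !E3 /= !(mul0r, mulr0, mul1r, subr0, addr0) oner_eq0.
- move=> X Y Z W; rewrite /d3 /wedge3 /wedge2 !w1E !w2E !w3E /dw2 /dw3 /wedge2 /conj_form.
  move: (1 / 2) (x%:C * 'i) ('i / _) => h p q; ring.
Qed.

End StructureEquations.

(** * The parameter is an invariant *)

Section Moduli.
Variable R : realType.
Local Notation V := 'rV[R]_6.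
Local Notation br := (@g3_bracket R).
Implicit Types (J : 'End(V)) (x : R).

Lemma g3_frame_pullback x J J' (F : 'End(V)) w1 w2 w3 :
  (forall X, J' (J' X) = - X) -> lie_automorphism br F ->
  (forall X, F (J X) = J' (F X)) -> g3_frame x J' w1 w2 w3 ->
  g3_frame x J (fun X => w1 (F X)) (fun X => w2 (F X)) (fun X => w3 (F X)).
Proof.
move=> JJ' [bijF autF] FJ [bw w1E w2E w3E].
have [w10 _ _] := bw.
have wF j X : triple (fun X => w1 (F X)) (fun X => w2 (F X))
    (fun X => w3 (F X)) j X = triple w1 w2 w3 j (F X).
  by elim/forall_I3: j.
split=> [|X Y|X Y|X Y].
- apply: basis10_intro => [j | X wX0]; last first.
    apply: (bij_inj bijF); rewrite linear0; apply: (basis10_inj JJ' bw) => j.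
    by rewrite -wF.
  split=> [a X Y | X]; rewrite !wF ?FJ ?linearP; first by apply: (w10 j).1.
  exact: (w10 j).2.
- by rewrite autF w1E.
- by rewrite autF w2E (dw2_comp _ _ _ (a := fun X => w1 (F X))
    (b := fun X => w3 (F X))).
- by rewrite autF w3E (dw3_comp _ _ _ (a := fun X => w1 (F X))
    (b := fun X => w2 (F X))).
Qed.

Lemma dw2_eval x (a b : V -> R[i]) X Y : a Y = 0 ->
  dw2 x a b X Y = - (1 / 2) * (a X * b Y)
    + (- (1 / 2 + x%:C * 'i)) * (a X * conjc (b Y))
    + (- (x%:C * 'i)) * (conjc (a X) * b Y).
Proof.
move=> aY0; rewrite /dw2 /wedge2 /conj_form aY0 rmorph0.
by move: (1 / 2) (x%:C * 'i) => h k; ring.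
Qed.

Lemma dw3_eval x (a b : V -> R[i]) X Y : a Y = 0 ->
  dw3 x a b X Y = 1 / 2 * (a X * b Y)
    + (1 / 2 - 'i / (4 * x%:C)) * (a X * conjc (b Y))
    + (- ('i / (4 * x%:C))) * (conjc (a X) * b Y).
Proof.
move=> aY0; rewrite /dw3 /wedge2 /conj_form aY0 rmorph0.
by move: (1 / 2) ('i / _) => h k; ring.
Qed.

(** The monomials z y, z conj(y) and conj(z) y are linearly independent over C:
    (z, y) = (1, 1), (i, 1), (1, i) suffice to separate the coefficients. *)
Lemma conj_monomials_eq (p A B G A' B' G' u v : R[i]) :
  (forall z y : R[i],
     p * (A * (z * y) + B * (z * conjc y) + G * (conjc z * y)) =
     A' * ((u * z) * (v * y)) + B' * ((u * z) * conjc (v * y))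
     + G' * (conjc (u * z) * (v * y))) ->
  p * A = A' * (u * v) /\ p * G = G' * (conjc u * v).
Proof.
move=> eqzy.
have ci : conjc 'i = - 'i :> R[i] by apply: complex_ext; rewrite /= ?oppr0.
have := eqzy 1 1; have := eqzy 'i 1; have := eqzy 1 'i.
have cM (z y : R[i]) : conjc (z * y) = conjc z * conjc y by exact: rmorphM.
rewrite !cM !conjc1 ci !(mulr1, mul1r).

move: (conjc u) (conjc v) => u' v' E1i Ei1 E11.
have two0 : 2 != 0 :> R[i] by rewrite pnatr_eq0.
set L := p * A - A' * (u * v); set N := p * G - G' * (u' * v).
set M := p * B - B' * (u * v').
have F11 : L + M + N = 0.
  by rewrite -[RHS](subrr (p * (A + B + G))) {2}E11 /L /M /N; ring.
have Fi1 : 'i * (L + M - N) = 0.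
  by rewrite -[RHS](subrr (p * (A * 'i + B * 'i + G * - 'i))) {2}Ei1 /L /M /N; ring.
have F1i : 'i * (L - M + N) = 0.
  by rewrite -[RHS](subrr (p * (A * 'i + B * - 'i + G * 'i))) {2}E1i /L /M /N; ring.
have i0 : 'i != 0 :> R[i] by apply/eqP => -[] /eqP; rewrite oner_eq0.
have {}Fi1 : L + M - N = 0 by apply: (mulfI i0); rewrite Fi1 mulr0.
have {}F1i : L - M + N = 0 by apply: (mulfI i0); rewrite F1i mulr0.
have N0 : N = 0.
  by apply: (mulfI two0); rewrite mulr0 -[RHS](subrr 0) -{1}F11 -Fi1; ring.
have M0 : M = 0.
  by apply: (mulfI two0); rewrite mulr0 -[RHS](subrr 0) -{1}F11 -F1i; ring.
move: F11; rewrite N0 M0 !addr0 => L0.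
by split; apply/eqP; rewrite -subr_eq0; apply/eqP.
Qed.

(** The second basis is w1' = c w1, w2' = p w2 + q w3 + r w1 and
    w3' = m w2 + t w3 + s w1.  The (2,0)-components give p = c t, t = c p,
    q = - c m and m = - c q, so that c = 1 or c = -1; the conj(w1) /\ w3
    and conj(w1) /\ w2 components of d w2' then give x = x' when t is
    non-zero, and the impossible 4 x x' = -1 otherwise. *)
Lemma g3_frame_parameter_unique x x' J w1 w2 w3 w1' w2' w3' :
  0 < x -> 0 < x' -> (forall X, J (J X) = - X) ->
  g3_frame x J w1 w2 w3 -> g3_frame x' J w1' w2' w3' -> x = x'.
Proof.
move=> x0 x0' JJ [bw w1E w2E w3E] [bw' w1E' w2E' w3E'].
have [w10 _ span_w] := bw; have [w10' _ _] := bw'.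
have [E dual] := dual_frame_exists w10 (fun X => @basis10_inj _ J _ X JJ bw).
have [E' dual'] := dual_frame_exists w10' (fun X => @basis10_inj _ J _ X JJ bw').
have span a : form10 J a -> exists c1 c2 c3 : R[i],
    forall X, a X = c1 * w1 X + c2 * w2 X + c3 * w3 X.
  move=> /span_w [c cE]; exists (c 0), (c 1), (c 2%:R) => X.
  by rewrite cE sum_I3.
pose X1 z := ccomb J E (fun j => if j == 0 then z else 0).
pose X2 z := ccomb J E (fun j => if j == 1 then z else 0).
pose X3 z := ccomb J E (fun j => if j == 2%:R then z else 0).
have wX k z : triple w1 w2 w3 k (ccomb J E z) = z k by apply: dual_frame_ccomb.
have w1X1 z : w1 (X1 z) = z := wX 0 _.
have w2X1 z : w2 (X1 z) = 0 := wX 1 _.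
have w3X1 z : w3 (X1 z) = 0 := wX 2%:R _.
have w1X2 z : w1 (X2 z) = 0 := wX 0 _.
have w2X2 z : w2 (X2 z) = z := wX 1 _.
have w3X2 z : w3 (X2 z) = 0 := wX 2%:R _.
have w1X3 z : w1 (X3 z) = 0 := wX 0 _.
have w2X3 z : w2 (X3 z) = 0 := wX 1 _.
have w3X3 z : w3 (X3 z) = z := wX 2%:R _.
have h0 : 1 / 2 != 0 :> R[i] by rewrite mul1r invr_eq0 pnatr_eq0.
have i0 : 'i != 0 :> R[i] by apply/eqP => -[] /eqP; rewrite oner_eq0.
have xC0 y : 0 < y -> y%:C != 0 by move=> y0; apply/eqP => -[] /eqP; rewrite gt_eqF.
have [c [c2 [c3 w1'E]]] := span _ (w10' 0).
have [r [p [q w2'E]]] := span _ (w10' 1).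
have [s [m [t w3'E]]] := span _ (w10' 2%:R).
rewrite /triple /= in w1'E w2'E w3'E.
(* The w1 /\ w2 and w1 /\ w3 components of d w1' = 0 are multiples of c3
   and of c2. *)
have c30 : c3 = 0.
  have/conj_monomials_eq [] : forall z y, c3 * (1 / 2 * (z * y)
      + (1 / 2 - 'i / (4 * x%:C)) * (z * conjc y)
      + - ('i / (4 * x%:C)) * (conjc z * y)) =
      0 * (1 * z * (1 * y)) + 0 * (1 * z * conjc (1 * y))
      + 0 * (conjc (1 * z) * (1 * y)).
    move=> z y; have := w1E' (X1 z) (X2 y); rewrite w1'E w1E w2E w3E.
    rewrite dw2_eval // dw3_eval // w1X1 w3X2 w2X2 conjc0 => eq0.
    transitivity (0 : R[i]); last by ring.
    by apply: oppr_inj; rewrite oppr0 -[RHS]eq0; ring.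
  by rewrite mul0r => /eqP; rewrite mulf_eq0 (negPf h0) orbF => /eqP.
have c20 : c2 = 0.
  have/conj_monomials_eq [] : forall z y, c2 * (- (1 / 2) * (z * y)
      + (- (1 / 2 + x%:C * 'i)) * (z * conjc y)
      + - (x%:C * 'i) * (conjc z * y)) =
      0 * (1 * z * (1 * y)) + 0 * (1 * z * conjc (1 * y))
      + 0 * (conjc (1 * z) * (1 * y)).
    move=> z y; have := w1E' (X1 z) (X3 y); rewrite w1'E w1E w2E w3E.
    rewrite dw2_eval // dw3_eval // w1X1 w3X3 w2X3 conjc0 => eq0.
    transitivity (0 : R[i]); last by ring.
    by apply: oppr_inj; rewrite oppr0 -[RHS]eq0; ring.
  by rewrite mul0r => /eqP; rewrite mulf_eq0 oppr_eq0 (negPf h0) orbF => /eqP.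
have {}w1'E X : w1' X = c * w1 X by rewrite w1'E c20 c30 !mul0r !addr0.
(* X1 z, X2 y and X3 y are the vectors with one complex coordinate; on such
   pairs the terms r w1 and s w1 do not contribute. *)
have eq2 X Y : dw2 x' w1' w3' X Y = p * dw2 x w1 w3 X Y + q * dw3 x w1 w2 X Y.
  by have := w2E' X Y; rewrite w2'E w1E w2E w3E mulr0 add0r => /eqP;
    rewrite !mulrN -opprD eqr_opp => /eqP.
have eq3 X Y : dw3 x' w1' w2' X Y = m * dw2 x w1 w3 X Y + t * dw3 x w1 w2 X Y.
  by have := w3E' X Y; rewrite w3'E w1E w2E w3E mulr0 add0r => /eqP;
    rewrite !mulrN -opprD eqr_opp => /eqP.
have w1'X z : w1' (X1 z) = c * z by rewrite w1'E w1X1.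
have w1'X2 z : w1' (X2 z) = 0 by rewrite w1'E w1X2 mulr0.
have w1'X3 z : w1' (X3 z) = 0 by rewrite w1'E w1X3 mulr0.
have w2'X2 z : w2' (X2 z) = p * z by rewrite w2'E w1X2 w2X2 w3X2 !mulr0 addr0 add0r.
have w2'X3 z : w2' (X3 z) = q * z by rewrite w2'E w1X3 w2X3 w3X3 !mulr0 !add0r.
have w3'X2 z : w3' (X2 z) = m * z by rewrite w3'E w1X2 w2X2 w3X2 !mulr0 addr0 add0r.
have w3'X3 z : w3' (X3 z) = t * z by rewrite w3'E w1X3 w2X3 w3X3 !mulr0 !add0r.
have [p_ct xp] : p * (- (1 / 2)) = - (1 / 2) * (c * t) /\
    p * (- (x%:C * 'i)) = - (x'%:C * 'i) * (conjc c * t).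
  apply: (conj_monomials_eq (B := - (1 / 2 + x%:C * 'i))
    (B' := - (1 / 2 + x'%:C * 'i))) => z y; have := eq2 (X1 z) (X3 y).
  rewrite !dw2_eval // dw3_eval // w1'X w3'X3 w1X1 w3X3 w2X3 => ->.
  by rewrite rmorph0 !mulr0 !addr0 mulr0 addr0.
have [q_cm xq] : q * (1 / 2) = - (1 / 2) * (c * m) /\
    q * (- ('i / (4 * x%:C))) = - (x'%:C * 'i) * (conjc c * m).
  apply: (conj_monomials_eq (B := 1 / 2 - 'i / (4 * x%:C))
    (B' := - (1 / 2 + x'%:C * 'i))) => z y; have := eq2 (X1 z) (X2 y).
  rewrite !dw2_eval // dw3_eval // w1'X w3'X2 w1X1 w3X2 w2X2 => E23.
  by rewrite E23 conjc0; ring.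
have [m_cq _] : m * (- (1 / 2)) = 1 / 2 * (c * q) /\
    m * (- (x%:C * 'i)) = - ('i / (4 * x'%:C)) * (conjc c * q).
  apply: (conj_monomials_eq (B := - (1 / 2 + x%:C * 'i))
    (B' := 1 / 2 - 'i / (4 * x'%:C))) => z y; have := eq3 (X1 z) (X3 y).
  rewrite !dw3_eval // dw2_eval // w1'X w2'X3 w1X1 w3X3 w2X3 => ->.
  by rewrite rmorph0 !mulr0 !addr0 mulr0 addr0.
have [t_cp _] : t * (1 / 2) = 1 / 2 * (c * p) /\
    t * (- ('i / (4 * x%:C))) = - ('i / (4 * x'%:C)) * (conjc c * p).
  apply: (conj_monomials_eq (B := 1 / 2 - 'i / (4 * x%:C))
    (B' := 1 / 2 - 'i / (4 * x'%:C))) => z y; have := eq3 (X1 z) (X2 y).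
  rewrite !dw3_eval // dw2_eval // w1'X w2'X2 w1X1 w3X2 w2X2 => E23.
  by rewrite E23 conjc0; ring.
have {}p_ct : p = c * t.
  by apply/(mulfI h0)/oppr_inj; transitivity (p * - (1 / 2));
    [ring | rewrite p_ct; ring].
have {}q_cm : q = - (c * m) by apply: (mulfI h0); rewrite mulrC q_cm; ring.
have {}m_cq : m = - (c * q).
  by apply/(mulfI h0)/oppr_inj; transitivity (m * - (1 / 2));
    [ring | rewrite m_cq; ring].
have {}t_cp : t = c * p by apply: (mulfI h0); rewrite mulrC t_cp.
have {}xp : x%:C * p = x'%:C * (conjc c * t).
  by apply/(mulfI i0)/oppr_inj; transitivity (p * (- (x%:C * 'i)));
    [ring | rewrite xp; ring].
have {}xq : q = 4 * x%:C * (x'%:C * (conjc c * m)).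
  apply: (mulfI i0).
  transitivity (- (4 * x%:C) * (q * - ('i / (4 * x%:C)))).
    by field; rewrite xC0.
  by rewrite xq; ring.
have c_real : c ^+ 2 = 1 -> conjc c = c.
  move=> /eqP; rewrite sqrf_eq1 => /orP[] /eqP ->; first exact: conjc1.
  by apply: complex_ext; rewrite /= ?oppr0.
have [t0 | t0] := eqVneq t 0; last first.
  have c1 : c ^+ 2 = 1.
    by apply: (mulIf t0); rewrite mul1r expr2 -mulrA -p_ct -t_cp.
  have c0 : c != 0 by apply: contra_eq_neq c1 => ->; rewrite expr0n eq_sym oner_eq0.
  apply: complexI; apply: (mulIf (mulf_neq0 c0 t0)).
  by rewrite -{1}p_ct xp c_real.
have m0 : m != 0.
  apply/eqP => m0.
  have wE' k j : triple w1' w2' w3' k (E' j) = (k == j)%:R := dual' k j.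
  have := wE' 2%:R 2%:R; rewrite /triple /= w3'E m0 t0 !mul0r !addr0 => s1.
  have := wE' 0 2%:R; rewrite /triple /= w1'E => /eqP; rewrite mulf_eq0 => /orP[] /eqP z0.
    by have := wE' 0 0; rewrite /triple /= w1'E z0 mul0r => /eqP; rewrite eq_sym oner_eq0.
  by move: s1; rewrite z0 mulr0 => /eqP; rewrite eq_sym oner_eq0.
have c1 : c ^+ 2 = 1.
  by apply: (mulIf m0); rewrite mul1r [RHS]m_cq q_cm; ring.
have c0 : c != 0 by apply: contra_eq_neq c1 => ->; rewrite expr0n eq_sym oner_eq0.
have : (4 * x * x')%:C = (-1)%:C.
  apply: (mulIf (mulf_neq0 c0 m0)).
  by rewrite rmorphN1 mulN1r -q_cm xq (c_real c1) !rmorphM rmorph_nat; ring.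
move=> /complexI xx'; have : 0 < 4 * x * x' by rewrite !mulr_gt0.
by rewrite xx' oppr_gt0 ltNge ler01.
Qed.

End Moduli.

(** * Closed (3,0)-forms and traces *)

Section Trace.
Variables (R : realType) (br : 'rV[R]_6 -> 'rV[R]_6 -> 'rV[R]_6).
Local Notation V := 'rV[R]_6.
Implicit Types (J : 'End(V)).

Definition etrace (C : V -> V) : R := \sum_k C (delta_mx 0 k) 0 k.

(** The trace of a real operator, computed in the real basis E_j, J E_j, whose
    dual basis is given by the real and imaginary parts of the w_j. *)
Lemma frame_trace J w E (C : 'End(V)) :
  (forall j, form10 J (w j)) -> dual_frame w E ->
  etrace C = \sum_j (Re (w j (C (E j))) + Im (w j (C (J (E j))))).
Proof.
move=> w10 dual.
have C_E j : Re (w j (C (E j))) =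
    \sum_k C (E j) 0 k * Re (w j (delta_mx 0 k)).
  rewrite [in LHS](row_sum_delta (C (E j))) complex_1form_sum; last by case: (w10 j).
  rewrite (big_morph (@complex.Re R) (id1 := 0) (op1 := +%R)) //; last by case=> ? ? [].
  apply: eq_bigr => k _; rewrite complex_1formZ; last by case: (w10 j).
  by case: (w j _) => a b /=; rewrite mul0r subr0.
have C_JE j : Im (w j (C (J (E j)))) =
    \sum_k C (J (E j)) 0 k * Im (w j (delta_mx 0 k)).
  rewrite [in LHS](row_sum_delta (C (J (E j)))) complex_1form_sum; last by case: (w10 j).
  rewrite (big_morph (@complex.Im R) (id1 := 0) (op1 := +%R)) //; last by case=> ? ? [].
  apply: eq_bigr => k _; rewrite complex_1formZ; last by case: (w10 j).
  by case: (w j _) => a b /=; rewrite mul0r addr0.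
under [RHS]eq_bigr => j _ do rewrite C_E C_JE -big_split /=.
rewrite exchange_big /=; apply: eq_bigr => k _.
rewrite {1}(ccomb_dual_frame (delta_mx 0 k) w10 dual) linear_sum summxE.
apply: eq_bigr => j _; rewrite linearD !linearZ /= !mxE.
by congr (_ + _); rewrite mulrC.
Qed.

Lemma form30_props J P : form30 J P ->
  [/\ forall Y Z, form10 J (fun X => P X Y Z),
      forall X Y Z, P Y X Z = - P X Y Z,
      forall X Y Z, P X Z Y = - P X Y Z
    & forall X Y, P X X Y = 0].
Proof.
case=> n [a [b [c [abc10 PE]]]].
split=> [Y Z | X Y Z | X Y Z | X Y].
- split=> [r X X' | X]; rewrite !PE mulr_sumr -?big_split;
    apply: eq_bigr => k _; have [[la aJ] [lb bJ] [lc cJ]] := abc10 k;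
    rewrite /wedge3 /wedge2 ?la ?lb ?lc ?aJ ?bJ ?cJ /=; ring.
- by rewrite !PE -sumrN; apply: eq_bigr => k _; rewrite /wedge3 /wedge2; ring.
- by rewrite !PE -sumrN; apply: eq_bigr => k _; rewrite /wedge3 /wedge2; ring.
- by rewrite PE big1 // => k _; rewrite /wedge3 /wedge2; ring.
Qed.

Lemma form10Z J (a : V -> R[i]) (z : R[i]) : form10 J a ->
  form10 J (fun X => z * a X).
Proof.
case=> la aJ; split=> [r X Y | X]; first by rewrite la mulrDr mulrCA.
by rewrite aJ mulrCA.
Qed.

(** The (1,0)-forms P(., E1, E2), P(E0, ., E2), P(E0, E1, .), divided by
    P(E0, E1, E2), form the frame dual to E.  In dP(X, E) + i dP(JX, E) the terms
    with a bracket [E_j, E_k] cancel, because P is of type (3,0); what remains is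
    the complex trace of ad(X) + J ad(JX).  Its real part is half of
    tr(ad(X)) + tr(J ad(JX)), by integrability of J. *)
Lemma closed_form30_trace J : is_lie_bracket br ->
  (forall X, etrace (br X) = 0) -> complex_structure br J ->
  has_closed_nonzero_form30 br J -> forall X, etrace (fun Z => J (br X Z)) = 0.
Proof.
move=> [brl brr br_alt _] unimod [JJ nijJ] [P [P30 [E0 [E1 [E2 P0]]] closedP]].
have [P10 P_12 P_23 P_11] := form30_props P30.
set p := P E0 E1 E2 in P0.
pose w := triple (fun X => p^-1 * P X E1 E2) (fun X => - p^-1 * P X E0 E2)
  (fun X => p^-1 * P X E0 E1).
pose E (j : 'I_3) : V := nth E0 [:: E0; E1; E2] j.
have w10 j : form10 J (w j) by elim/forall_I3: j; exact: form10Z.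
have P_1x1 X Y : P X Y X = 0 by rewrite P_23 P_11 oppr0.
have P_x11 X Y : P X Y Y = 0 by rewrite P_12 P_1x1 oppr0.
have dual : dual_frame w E.
  move=> k j; elim/forall_I3: k; elim/forall_I3: j; rewrite /w /E /triple /=;
    rewrite ?P_11 ?P_1x1 ?P_x11 ?mulr0 ?mulVf //.
  - by rewrite P_12 mulrNN mulVf.
  - by rewrite P_12 P_23 opprK mulVf.
have w_sum X : \sum_j (w j (br X (E j)) + 'i * w j (br (J X) (E j))) = 0.
  have ii : 1 + 'i * 'i = 0 :> R[i] by rewrite -expr2 sqrCi subrr.
  have L0 := closedP X E0 E1 E2; have L1 := closedP (J X) E0 E1 E2.
  move: L0 L1; rewrite /d3.
  rewrite !(P_12 X (br _ _)) !(P_12 (J X) (br _ _)) !(P10 _ _).2 => L0 L1.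
  move: L0 L1; set l0 := (l in l = _ -> _) => L0; set l1 := (l in l = _ -> _) => L1.
  transitivity (- p^-1 * (l0 + 'i * l1) + p^-1 * (1 + 'i * 'i)
      * (P X (br E0 E1) E2 - P X (br E0 E2) E1 + P X (br E1 E2) E0)).
    by rewrite sum_I3 /w /E /triple /l0 /l1 /=; ring.
  by rewrite L0 L1 ii; ring.
have lin_br X : linear (br X) by move=> r Y Z; exact: brr.
move=> Y; pose X := - J Y.
have JX : J X = Y by rewrite /X linearN /= JJ opprK.
have [C CE] := linear_lfun (lin_br X).
have linJbr : linear (fun Z => J (br Y Z)) by move=> r Z Z'; rewrite brr linearP.
have [D DE] := linear_lfun linJbr.
have trC : etrace C = 0.
  by rewrite -[RHS](unimod X); apply: eq_bigr => k _; rewrite CE.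
have -> : etrace (fun Z => J (br Y Z)) = etrace D.
  by apply: eq_bigr => k _; rewrite DE.
have wJ j Z : w j (J Z) = 'i * w j Z by case: (w10 j).
have wD j Z Z' : w j (Z + Z') = w j Z + w j Z'.
  by apply: complex_1formD; case: (w10 j).
have ReiM (z : R[i]) : Re ('i * z) = - Im z by case: z => u v /=; ring.
have ImiM (z : R[i]) : Im ('i * z) = Re z by case: z => u v /=; ring.
have ReD (z z' : R[i]) : Re (z + z') = Re z + Re z' by case: z z' => [? ?] [].
have ImD (z z' : R[i]) : Im (z + z') = Im z + Im z' by case: z z' => [? ?] [].
have brJJ Z : br Y (J Z) = J (br Y Z) + J (br X (J Z)) + br X Z.
  have := nijJ X Z; rewrite /nijenhuis JX => /eqP.
  rewrite subr_eq add0r subr_eq subr_eq => /eqP ->.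
  by rewrite [RHS]addrC [J (br Y Z) + _]addrC addrA.
move: trC; rewrite !(frame_trace _ w10 dual) !sum_I3 !CE !DE !wJ !brJJ !wD !wJ.
have := congr1 (@complex.Re R) (w_sum X); rewrite sum_I3 JX.
rewrite !ImiM !(ReD, ReiM) /=.
set x := br X; set y := br Y; lra.
Qed.

End Trace.

(** * Complex structures on g_3 in coordinates *)

Section Coordinates.
Variable R : realType.
Local Notation V := 'rV[R]_6.
Local Notation br := (@g3_bracket R).
Implicit Types (J : 'End(V)) (X Y : V).

Definition ev k : V := delta_mx 0 (inord k.-1).

Lemma e_ev j k : (0 < j <= 6)%N -> (0 < k <= 6)%N -> e j (ev k) = (j == k)%:R.
Proof.
case: j k => // j [] // k /= ltj ltk.
by rewrite /e /ev mxE eqxx -val_eqE /= !inordK.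
Qed.

Lemma sum_I6 (T : nmodType) (F : 'I_6 -> T) :
  \sum_k F k = F (inord 0) + F (inord 1) + F (inord 2) + F (inord 3)
    + F (inord 4) + F (inord 5).
Proof.
rewrite !big_ord_recl big_ord0 addr0 !addrA.
by congr (F _ + F _ + F _ + F _ + F _ + F _); apply: val_inj; rewrite /= inordK.
Qed.

Lemma e_lfun J k X : e k (J X) =
  e 1 X * e k (J (ev 1)) + e 2 X * e k (J (ev 2)) + e 3 X * e k (J (ev 3))
  + e 4 X * e k (J (ev 4)) + e 5 X * e k (J (ev 5)) + e 6 X * e k (J (ev 6)).
Proof.
rewrite {1}(row_sum_delta X) linear_sum /e summxE sum_I6.
by rewrite !linearZ /= !mxE.
Qed.

Lemma etraceE (C : V -> V) : etrace C =
  e 1 (C (ev 1)) + e 2 (C (ev 2)) + e 3 (C (ev 3))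
  + e 4 (C (ev 4)) + e 5 (C (ev 5)) + e 6 (C (ev 6)).
Proof. by rewrite /etrace sum_I6. Qed.

Lemma e_br X Y :
  [/\ e 1 (br X Y) = 0,
      e 2 (br X Y) = e 1 X * e 3 Y - e 1 Y * e 3 X,
      e 3 (br X Y) = - (e 1 X * e 2 Y - e 1 Y * e 2 X)
    & [/\ e 4 (br X Y) = 0,
      e 5 (br X Y) = e 4 X * e 6 Y - e 4 Y * e 6 X
    & e 6 (br X Y) = e 4 X * e 5 Y - e 4 Y * e 5 X]].
Proof.
have eB k : (0 < k <= 6)%N -> e k (br X Y) = - g3_de k X Y.
  by move=> /d_e <-; rewrite opprK.
by rewrite !eB //= /e2 /wedge2 !opprK !oppr0.
Qed.

Lemma g3_unimodular X : etrace (br X) = 0.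
Proof.
rewrite etraceE.
have [-> _ _ _] := e_br X (ev 1); have [_ -> _ _] := e_br X (ev 2).
have [_ _ -> _] := e_br X (ev 3); have [_ _ _ [-> _ _]] := e_br X (ev 4).
have [_ _ _ [_ -> _]] := e_br X (ev 5); have [_ _ _ [_ _ ->]] := e_br X (ev 6).
by rewrite !e_ev //=; ring.
Qed.

Lemma e_J_br J k X Y : e k (J (br X Y)) =
  (e 1 X * e 3 Y - e 1 Y * e 3 X) * e k (J (ev 2))
  - (e 1 X * e 2 Y - e 1 Y * e 2 X) * e k (J (ev 3))
  + (e 4 X * e 6 Y - e 4 Y * e 6 X) * e k (J (ev 5))
  + (e 4 X * e 5 Y - e 4 Y * e 5 X) * e k (J (ev 6)).
Proof.
by rewrite e_lfun; have [-> -> -> [-> -> ->]] := e_br X Y; ring.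
Qed.

Lemma e_nijenhuis J k X Y : e k (nijenhuis br J X Y) =
  e k (br (J X) (J Y)) - e k (J (br (J X) Y)) - e k (J (br X (J Y)))
  - e k (br X Y).
Proof. by rewrite /e !mxE. Qed.

(** The matrix of J, with the index of the argument first. *)
Definition Jcoef J m k : R := e k (J (ev m)).

Lemma sum_sqr_neq_N1 (a b : R) : a ^+ 2 + b ^+ 2 != -1.
Proof.
apply/eqP => ab; have : 0 <= a ^+ 2 + b ^+ 2 by rewrite addr_ge0 ?sqr_ge0.
by rewrite ab oppr_ge0 leNgt ltr01.
Qed.

(** These are the conditions tr(J ad(Y)) = 0 for Y among e_3, e_2, e_6, e_5, e_1. *)
Lemma closed_form30_coords J : complex_structure br J ->
  has_closed_nonzero_form30 br J ->
  [/\ Jcoef J 2 1 = 0, Jcoef J 3 1 = 0, Jcoef J 5 4 = 0, Jcoef J 6 4 = 0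
    & Jcoef J 2 3 = Jcoef J 3 2].
Proof.
move=> cJ closedJ.
have tr0 := closed_form30_trace (@g3_lie R) g3_unimodular cJ closedJ.
split.
- have := tr0 (ev 3); rewrite etraceE !e_J_br !e_ev //= -!/(Jcoef _ _ _) => eq0.
  by apply: oppr_inj; rewrite oppr0 -[RHS]eq0; ring.
- have := tr0 (ev 2); rewrite etraceE !e_J_br !e_ev //= -!/(Jcoef _ _ _) => eq0.
  by rewrite -[RHS]eq0; ring.
- have := tr0 (ev 6); rewrite etraceE !e_J_br !e_ev //= -!/(Jcoef _ _ _) => eq0.
  by apply: oppr_inj; rewrite oppr0 -[RHS]eq0; ring.
- have := tr0 (ev 5); rewrite etraceE !e_J_br !e_ev //= -!/(Jcoef _ _ _) => eq0.
  by apply: oppr_inj; rewrite oppr0 -[RHS]eq0; ring.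
- have := tr0 (ev 1); rewrite etraceE !e_J_br !e_ev //= -!/(Jcoef _ _ _) => eq0.
  apply/eqP; rewrite -subr_eq0; apply/eqP; rewrite -[RHS]eq0; ring.
Qed.

Lemma e_br1 X Y : e 1 (br X Y) = 0. Proof. by case: (e_br X Y). Qed.
Lemma e_br2 X Y : e 2 (br X Y) = e 1 X * e 3 Y - e 1 Y * e 3 X.
Proof. by case: (e_br X Y). Qed.
Lemma e_br3 X Y : e 3 (br X Y) = - (e 1 X * e 2 Y - e 1 Y * e 2 X).
Proof. by case: (e_br X Y). Qed.
Lemma e_br4 X Y : e 4 (br X Y) = 0.
Proof. by case: (e_br X Y) => _ _ _ []. Qed.
Lemma e_br5 X Y : e 5 (br X Y) = e 4 X * e 6 Y - e 4 Y * e 6 X.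
Proof. by case: (e_br X Y) => _ _ _ []. Qed.
Lemma e_br6 X Y : e 6 (br X Y) = e 4 X * e 5 Y - e 4 Y * e 5 X.
Proof. by case: (e_br X Y) => _ _ _ []. Qed.

(** The first three groups say that J preserves the ideal n and maps e_1 to
    +- e_4 modulo n.  With P and Q the blocks of J from <e_2, e_3> and <e_5, e_6>
    to <e_2, e_3>, the fourth says that P is symmetric of determinant -1 and that
    Q is invertible, and the last that Q intertwines the swap of e_5 and e_6
    with -+ P times a quarter turn. *)
Lemma complex_structure_coords J : complex_structure br J ->
  has_closed_nonzero_form30 br J ->
  [/\ [/\ Jcoef J 2 1 = 0, Jcoef J 3 1 = 0, Jcoef J 5 1 = 0 & Jcoef J 6 1 = 0],
      [/\ Jcoef J 2 4 = 0, Jcoef J 3 4 = 0, Jcoef J 5 4 = 0 & Jcoef J 6 4 = 0],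
      [/\ Jcoef J 1 1 = 0, Jcoef J 4 1 = - Jcoef J 1 4 & Jcoef J 1 4 ^+ 2 = 1],
      [/\ Jcoef J 2 3 = Jcoef J 3 2, Jcoef J 2 2 * Jcoef J 3 3 - Jcoef J 3 2 ^+ 2 = -1
        & Jcoef J 5 2 * Jcoef J 6 3 - Jcoef J 5 3 * Jcoef J 6 2 != 0]
    & [/\ Jcoef J 1 4 * Jcoef J 6 2 = Jcoef J 5 2 * Jcoef J 3 2 - Jcoef J 5 3 * Jcoef J 2 2,
          Jcoef J 1 4 * Jcoef J 6 3 = Jcoef J 5 2 * Jcoef J 3 3 - Jcoef J 5 3 * Jcoef J 3 2,
          Jcoef J 1 4 * Jcoef J 5 2 = Jcoef J 6 2 * Jcoef J 3 2 - Jcoef J 6 3 * Jcoef J 2 2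
        & Jcoef J 1 4 * Jcoef J 5 3 = Jcoef J 6 2 * Jcoef J 3 3 - Jcoef J 6 3 * Jcoef J 3 2]].
Proof.
move=> cJ closedJ.
have [j21 j31 j54 j64 j23] := closed_form30_coords cJ closedJ.
case: cJ => JJ nijJ.
have nij k m l : e k (nijenhuis br J (ev m) (ev l)) = 0.
  by rewrite nijJ /e mxE.
have sq m k : (0 < m <= 6)%N -> (0 < k <= 6)%N ->
    Jcoef J m 1 * Jcoef J 1 k + Jcoef J m 2 * Jcoef J 2 k + Jcoef J m 3 * Jcoef J 3 k
    + Jcoef J m 4 * Jcoef J 4 k + Jcoef J m 5 * Jcoef J 5 k + Jcoef J m 6 * Jcoef J 6 k
    = - (k == m)%:R.
  move=> m6 k6; have := congr1 (e k) (JJ (ev m)); rewrite e_lfun => ->.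
  by rewrite -(e_ev k6 m6) /e mxE.
(* If J e_2 or J e_3 has an e_4-component, N(e_2, e_3) = 0 makes J map
   v = j24 e_3 - j34 e_2 into <e_2, e_3>; there J is symmetric, so
   |J v|^2 = <v, J^2 v> = - |v|^2. *)
have j24_34 : Jcoef J 2 4 = 0 /\ Jcoef J 3 4 = 0.
  have n5 := nij 5 2 3; have n6 := nij 6 2 3.
  rewrite !e_nijenhuis !e_J_br !e_br5 !e_ev //= -!/(Jcoef _ _ _) j21 j31 in n5.
  rewrite !e_nijenhuis !e_J_br !e_br6 !e_ev //= -!/(Jcoef _ _ _) j21 j31 in n6.
  have s22 := sq 2 2 isT isT; have s32 := sq 3 2 isT isT.
  have s23 := sq 2 3 isT isT; have s33 := sq 3 3 isT isT.
  rewrite j21 j31 j23 /= in s22 s32 s23 s33.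
  move: n5 n6 s22 s32 s23 s33.
  set a := Jcoef J 2 2; set b := Jcoef J 3 2; set d := Jcoef J 3 3.
  set u := Jcoef J 2 4; set v := Jcoef J 3 4 => n5 n6 s22 s32 s23 s33.
  have n5' : u * Jcoef J 3 6 - v * Jcoef J 2 6 = 0 by rewrite -[RHS]n5; ring.
  have n6' : u * Jcoef J 3 5 - v * Jcoef J 2 5 = 0 by rewrite -[RHS]n6; ring.
  have sum0 : (u * b - v * a) ^+ 2 + (u * d - v * b) ^+ 2 + u ^+ 2 + v ^+ 2 = 0.
    have y2 : (u * b - v * a) * a + (u * d - v * b) * b = v.
      transitivity (u * - 0%:R - v * - 1%:R
        - Jcoef J 6 2 * (u * Jcoef J 3 6 - v * Jcoef J 2 6)
        - Jcoef J 5 2 * (u * Jcoef J 3 5 - v * Jcoef J 2 5)); last by rewrite n5' n6'; ring.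
      by rewrite -s22 -s32; ring.
    have y3 : (u * b - v * a) * b + (u * d - v * b) * d = - u.
      transitivity (u * - 1%:R - v * - 0%:R
        - Jcoef J 6 3 * (u * Jcoef J 3 6 - v * Jcoef J 2 6)
        - Jcoef J 5 3 * (u * Jcoef J 3 5 - v * Jcoef J 2 5)); last by rewrite n5' n6'; ring.
      by rewrite -s23 -s33; ring.
    transitivity (u * ((u * b - v * a) * b + (u * d - v * b) * d + u)
        + v * (v - ((u * b - v * a) * a + (u * d - v * b) * b))); first by ring.
    by rewrite y2 y3; ring.
  have := sqr_ge0 (u * b - v * a); have := sqr_ge0 (u * d - v * b).
  have := sqr_ge0 u; have := sqr_ge0 v => v2 u2 x2 y2.
  by split; apply/eqP; rewrite -sqrf_eq0; apply/eqP; lra.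
case: j24_34 => j24 j34.
(* A symmetric real 2 x 2 matrix does not square to -1, so J e_3 is not in
   <e_2, e_3>; but a non-zero e_1-component of J e_5 or J e_6 would force that. *)
have s33_neq : Jcoef J 3 5 = 0 -> Jcoef J 3 6 = 0 -> False.
  move=> j35 j36; have := sq 3 3 isT isT; rewrite j31 j34 j35 j36 j23 /= => s33.
  have /eqP := sum_sqr_neq_N1 (Jcoef J 3 2) (Jcoef J 3 3); apply.
  by rewrite -[RHS]s33; ring.
have j51 : Jcoef J 5 1 = 0.
  have n5 := nij 5 5 2; have n6 := nij 6 5 2.
  rewrite !e_nijenhuis !e_J_br !e_br5 !e_ev //= -!/(Jcoef _ _ _) j24 j54 in n5.
  rewrite !e_nijenhuis !e_J_br !e_br6 !e_ev //= -!/(Jcoef _ _ _) j24 j54 in n6.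
  apply/eqP/negPn/negP => j51; apply: s33_neq; apply: (mulfI j51); rewrite mulr0.
    by rewrite -[RHS]n5; ring.
  by rewrite -[RHS]n6; ring.
have j61 : Jcoef J 6 1 = 0.
  have n5 := nij 5 6 2; have n6 := nij 6 6 2.
  rewrite !e_nijenhuis !e_J_br !e_br5 !e_ev //= -!/(Jcoef _ _ _) j24 j64 in n5.
  rewrite !e_nijenhuis !e_J_br !e_br6 !e_ev //= -!/(Jcoef _ _ _) j24 j64 in n6.
  apply/eqP/negPn/negP => j61; apply: s33_neq; apply: (mulfI j61); rewrite mulr0.
    by rewrite -[RHS]n5; ring.
  by rewrite -[RHS]n6; ring.
(* On <e_2, e_3>, with rho the quarter turn, N(e_1, .) = 0 reads
   j11 (rho P - P rho) = P rho P + rho, where P rho P = (det P) rho; the left-hand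
   side is symmetric and the right-hand side antisymmetric, so both vanish. *)
have n122 := nij 2 1 2; have n132 := nij 2 1 3; have n123 := nij 3 1 2.
rewrite !e_nijenhuis !e_J_br !e_br2 !e_ev //= -!/(Jcoef _ _ _) j21 j24 j23 in n122.
rewrite !e_nijenhuis !e_J_br !e_br2 !e_ev //= -!/(Jcoef _ _ _) j31 j34 in n132.
rewrite !e_nijenhuis !e_J_br !e_br3 !e_ev //= -!/(Jcoef _ _ _) j21 j24 j23 in n123.
have detP : Jcoef J 2 2 * Jcoef J 3 3 - Jcoef J 3 2 ^+ 2 = -1.
  lra.
have j11 : Jcoef J 1 1 = 0.
  apply/eqP/negPn/negP => j11.
  have b0 : Jcoef J 3 2 = 0 by apply: (mulfI j11); rewrite mulr0; lra.
  have ad : Jcoef J 3 3 = Jcoef J 2 2 by apply: (mulfI j11); lra.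
  have /eqP := sum_sqr_neq_N1 (Jcoef J 3 2) (Jcoef J 2 2); apply.
  by rewrite -[RHS]detP ad b0; ring.
have s11 := sq 1 1 isT isT.
have {}s11 : Jcoef J 1 4 * Jcoef J 4 1 = -1.
  by move: s11; rewrite /= j11 j21 j31 j51 j61; lra.
have Q1 : Jcoef J 1 4 * Jcoef J 6 2 = Jcoef J 5 2 * Jcoef J 3 2 - Jcoef J 5 3 * Jcoef J 2 2.
  have := nij 2 1 5.
  by rewrite !e_nijenhuis !e_J_br !e_br2 !e_ev //= -!/(Jcoef _ _ _) j11 j51 j54; lra.
have Q2 : Jcoef J 1 4 * Jcoef J 6 3 = Jcoef J 5 2 * Jcoef J 3 3 - Jcoef J 5 3 * Jcoef J 3 2.
  have := nij 3 1 5.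
  by rewrite !e_nijenhuis !e_J_br !e_br3 !e_ev //= -!/(Jcoef _ _ _) j11 j51 j54 j23; lra.
have Q3 : Jcoef J 1 4 * Jcoef J 5 2 = Jcoef J 6 2 * Jcoef J 3 2 - Jcoef J 6 3 * Jcoef J 2 2.
  have := nij 2 1 6.
  by rewrite !e_nijenhuis !e_J_br !e_br2 !e_ev //= -!/(Jcoef _ _ _) j11 j61 j64; lra.
have Q4 : Jcoef J 1 4 * Jcoef J 5 3 = Jcoef J 6 2 * Jcoef J 3 3 - Jcoef J 6 3 * Jcoef J 3 2.
  have := nij 3 1 6.
  by rewrite !e_nijenhuis !e_J_br !e_br3 !e_ev //= -!/(Jcoef _ _ _) j11 j61 j64 j23; lra.
(* J^2 = -1 gives Q K = - (1 + P^2), with K the block from <e_2, e_3> to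
   <e_5, e_6>, and 1 + P^2 is positive definite. *)
have detQ : Jcoef J 5 2 * Jcoef J 6 3 - Jcoef J 5 3 * Jcoef J 6 2 != 0.
  apply/eqP => detQ0.
  have s22 := sq 2 2 isT isT; have s32 := sq 3 2 isT isT.
  have s23 := sq 2 3 isT isT; have s33 := sq 3 3 isT isT.
  rewrite j21 j31 j24 j34 j23 /= in s22 s32 s23 s33.
  move: detQ0 s22 s32 s23 s33.
  set a := Jcoef J 2 2; set b := Jcoef J 3 2; set d := Jcoef J 3 3.
  move=> detQ0 s22 s32 s23 s33.
  have : (1 + a ^+ 2 + b ^+ 2) * (1 + b ^+ 2 + d ^+ 2) - (b * (a + d)) ^+ 2 = 0.
    transitivity ((Jcoef J 5 2 * Jcoef J 6 3 - Jcoef J 5 3 * Jcoef J 6 2)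
      * (Jcoef J 2 5 * Jcoef J 3 6 - Jcoef J 2 6 * Jcoef J 3 5)); last by rewrite detQ0 mul0r.
    transitivity ((Jcoef J 2 5 * Jcoef J 5 2 + Jcoef J 2 6 * Jcoef J 6 2)
      * (Jcoef J 3 5 * Jcoef J 5 3 + Jcoef J 3 6 * Jcoef J 6 3)
      - (Jcoef J 2 5 * Jcoef J 5 3 + Jcoef J 2 6 * Jcoef J 6 3)
      * (Jcoef J 3 5 * Jcoef J 5 2 + Jcoef J 3 6 * Jcoef J 6 2)); last by ring.
    have -> : Jcoef J 2 5 * Jcoef J 5 2 + Jcoef J 2 6 * Jcoef J 6 2 = - (1 + a ^+ 2 + b ^+ 2).
      by lra.
    have -> : Jcoef J 3 5 * Jcoef J 5 3 + Jcoef J 3 6 * Jcoef J 6 3 = - (1 + b ^+ 2 + d ^+ 2).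
      by lra.
    have -> : Jcoef J 2 5 * Jcoef J 5 3 + Jcoef J 2 6 * Jcoef J 6 3 = - (b * (a + d)) by lra.
    have -> : Jcoef J 3 5 * Jcoef J 5 2 + Jcoef J 3 6 * Jcoef J 6 2 = - (b * (a + d)) by lra.
    by ring.
  have := sqr_ge0 a; have := sqr_ge0 b; have := sqr_ge0 d.
  have := sqr_ge0 (b ^+ 2 - a * d); lra.
(* Applying the intertwining relation twice multiplies Q by j14^2 on one side
   and by (P rho)^2 = - det P = 1 on the other. *)
have j14 : Jcoef J 1 4 ^+ 2 = 1.
  apply/eqP; rewrite -subr_eq0; apply/negPn/negP => j14.
  have q52 : Jcoef J 5 2 = 0.
    apply: (mulfI j14); rewrite mulr0.
    transitivity (Jcoef J 1 4 * (Jcoef J 1 4 * Jcoef J 5 2) - Jcoef J 5 2); first by ring.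
    rewrite Q3.
    transitivity (Jcoef J 3 2 * (Jcoef J 1 4 * Jcoef J 6 2)
      - Jcoef J 2 2 * (Jcoef J 1 4 * Jcoef J 6 3) - Jcoef J 5 2); first by ring.
    rewrite Q1 Q2.
    transitivity (Jcoef J 5 2
      * (- (Jcoef J 2 2 * Jcoef J 3 3 - Jcoef J 3 2 ^+ 2) - 1)); first by ring.
    by rewrite detP; ring.
  have q53 : Jcoef J 5 3 = 0.
    apply: (mulfI j14); rewrite mulr0.
    transitivity (Jcoef J 1 4 * (Jcoef J 1 4 * Jcoef J 5 3) - Jcoef J 5 3); first by ring.
    rewrite Q4.
    transitivity (Jcoef J 3 3 * (Jcoef J 1 4 * Jcoef J 6 2)
      - Jcoef J 3 2 * (Jcoef J 1 4 * Jcoef J 6 3) - Jcoef J 5 3); first by ring.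
    rewrite Q1 Q2.
    transitivity (Jcoef J 5 3
      * (- (Jcoef J 2 2 * Jcoef J 3 3 - Jcoef J 3 2 ^+ 2) - 1)); first by ring.
    by rewrite detP; ring.
  by move: detQ; rewrite q52 q53 !mul0r subrr eqxx.
have j14_neq0 : Jcoef J 1 4 != 0.
  by apply: contra_eq_neq j14 => ->; rewrite expr0n eq_sym oner_eq0.
split=> //; split=> //.
by apply: (mulfI j14_neq0); rewrite s11 mulrN -expr2 j14.
Qed.

End Coordinates.

(** * Normal form *)

Section NormalForm.
Variable R : realType.
Local Notation V := 'rV[R]_6.
Local Notation br := (@g3_bracket R).
Implicit Types (J : 'End(V)) (X Y : V) (x : R).

(** The orthogonal diagonalization of the symmetric matrix (a, b; b, d), whose
    eigenvalues are la < 0 and -1/la; (c, s) is a unit eigenvector for la. *)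
Lemma sym_det_N1_diag (a b d : R) : a * d - b ^+ 2 = -1 ->
  exists la c s : R, [/\ la < 0, c ^+ 2 + s ^+ 2 = 1,
    a * c + b * s = la * c, b * c + d * s = la * s
    & - (a * s) + b * c = la^-1 * s /\ - (b * s) + d * c = - la^-1 * c].
Proof.
move=> detP.
pose S := Num.sqrt ((a + d) ^+ 2 + 4).
have S2 : S ^+ 2 = (a + d) ^+ 2 + 4.
  by rewrite sqr_sqrtr // addr_ge0 ?sqr_ge0 ?ler0n.
have S0 : 0 < S by rewrite sqrtr_gt0 ltr_wpDl ?sqr_ge0 ?ltr0n.
pose la := ((a + d) - S) / 2; exists la.
have la_neg : la < 0.
  suff : a + d < S by rewrite /la; lra.
  rewrite ltNge; apply/negP => leS.
  have : S ^+ 2 <= (a + d) ^+ 2 by rewrite ler_sqr // nnegrE ?ltW //; lra.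
  by rewrite S2; lra.
have la0 : la != 0 by rewrite lt_eqF.
have la_eq : la * (a + d - la) = -1.
  transitivity (((a + d) ^+ 2 - S ^+ 2) / 4); first by rewrite /la; field.
  by rewrite S2; field.
have inv_la : la^-1 = la - (a + d).
  by apply: (mulfI la0); rewrite mulfV // -[1]opprK -la_eq; ring.
have al_de : (a - la) * (d - la) = b ^+ 2.
  transitivity (a * d - la * (a + d - la)); first by ring.
  by rewrite la_eq; lra.
suff [c [s [cs1 eq1 eq2]]] : exists c s : R,
    [/\ c ^+ 2 + s ^+ 2 = 1, (a - la) * c + b * s = 0
      & b * c + (d - la) * s = 0].
  by exists c, s; rewrite inv_la; split=> //; [lra | lra | split; lra].
have [de0 | de0] := eqVneq (d - la) 0.
  exists 0, 1; have b0 : b = 0.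
    by apply/eqP; rewrite -sqrf_eq0 -al_de de0 mulr0.
  by rewrite b0 de0; split; ring.
pose n := Num.sqrt ((d - la) ^+ 2 + b ^+ 2).
have n2 : n ^+ 2 = (d - la) ^+ 2 + b ^+ 2.
  by rewrite sqr_sqrtr // addr_ge0 ?sqr_ge0.
have n0 : n != 0.
  rewrite gt_eqF // sqrtr_gt0 ltr_pwDl ?sqr_ge0 //.
  by rewrite lt_neqAle sqr_ge0 eq_sym sqrf_eq0 de0.
exists ((d - la) / n), (- b / n); split.
- by rewrite !expr_div_n sqrrN -mulrDl -n2 mulfV // sqrf_eq0.
- transitivity (((a - la) * (d - la) - b ^+ 2) / n); first by ring.
  by rewrite al_de subrr mul0r.
- by ring.
Qed.

(** The structure equations have no (0,2)-component: each product of two basic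
    forms in them contributes nothing to w_k(N(X, Y)). *)
Lemma g3_frame_complex_structure x J w1 w2 w3 : (forall X, J (J X) = - X) ->
  g3_frame x J w1 w2 w3 -> complex_structure br J.
Proof.
move=> JJ [bw w1E w2E w3E]; split=> // X Y.
apply: (basis10_inj JJ bw) => j; have [w10 _ _] := bw.
have wJ k Z : triple w1 w2 w3 k (J Z) = 'i * triple w1 w2 w3 k Z.
  by case: (w10 k).
have w1J Z : w1 (J Z) = 'i * w1 Z := wJ 0 Z.
have w2J Z : w2 (J Z) = 'i * w2 Z := wJ 1 Z.
have w3J Z : w3 (J Z) = 'i * w3 Z := wJ 2%:R Z.
have lin_w : complex_1form (triple w1 w2 w3 j) by case: (w10 j).
rewrite /nijenhuis !(complex_1formD, complex_1formN) // !wJ.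
elim/forall_I3: j lin_w => _; rewrite /triple /=.
- by rewrite !w1E; ring.
- rewrite !w2E /dw2 /wedge2 /conj_form !w1J !w3J.
  move: (1 / 2) (x%:C * 'i); rewrite -!['i]/(0 +i* 1) => -[h1 h2] [k1 k2].
  case: (w1 X) (w1 Y) (w3 X) (w3 Y) => [aX bX] [aY bY] [cX dX] [cY dY].
  by apply: complex_ext => /=; ring.
- rewrite !w3E /dw3 /wedge2 /conj_form !w1J !w2J.
  move: (1 / 2) ('i / _); rewrite -!['i]/(0 +i* 1) => -[h1 h2] [k1 k2].
  case: (w1 X) (w1 Y) (w2 X) (w2 Y) => [aX bX] [aY bY] [cX dX] [cY dY].
  by apply: complex_ext => /=; ring.
Qed.

(** In real terms, with w1 = a + i b and w3 = a3 + i b3, the structure equation is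
    d a2 = - a /\ a3 and d b2 = - 2x (a /\ a3 + b /\ b3) - b /\ a3. *)
Lemma dw2E x (w1 w3 : V -> R[i]) X Y :
  let a X := Re (w1 X) in let b X := Im (w1 X) in
  let a3 X := Re (w3 X) in let b3 X := Im (w3 X) in
  dw2 x w1 w3 X Y = (- wedge2 a a3 X Y)
    +i* (- (2 * x) * (wedge2 a a3 X Y + wedge2 b b3 X Y) - wedge2 b a3 X Y).
Proof.
have h : 1 / 2 = (2^-1)%:C :> R[i] by rewrite mul1r fmorphV rmorph_nat.
rewrite /dw2 h /wedge2 /conj_form /=.
rewrite -!['i]/(0 +i* 1).
case: (w1 X) (w1 Y) (w3 X) (w3 Y) => [aX bX] [aY bY] [cX dX] [cY dY].
by apply: complex_ext => /=; field.
Qed.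

(** Likewise d a3 = a /\ a2 and d b3 = - (2x)^-1 (a /\ a2 + b /\ b2) + b /\ a2. *)
Lemma dw3E x (w1 w2 : V -> R[i]) X Y : x != 0 ->
  let a X := Re (w1 X) in let b X := Im (w1 X) in
  let a2 X := Re (w2 X) in let b2 X := Im (w2 X) in
  dw3 x w1 w2 X Y = wedge2 a a2 X Y
    +i* (- (2 * x)^-1 * (wedge2 a a2 X Y + wedge2 b b2 X Y) + wedge2 b a2 X Y).
Proof.
move=> x0.
have h : 1 / 2 = (2^-1)%:C :> R[i] by rewrite mul1r fmorphV rmorph_nat.
have k : 'i / (4 * x%:C) = 0 +i* (4 * x)^-1 :> R[i].
  have -> : 4 * x%:C = (4 * x)%:C by rewrite rmorphM rmorph_nat.
  by rewrite -fmorphV -['i]/(0 +i* 1); apply: complex_ext => /=; ring.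
rewrite /dw3 h k /wedge2 /conj_form /=.
case: (w1 X) (w1 Y) (w2 X) (w2 Y) => [aX bX] [aY bY] [cX dX] [cY dY].
by apply: complex_ext => /=; field; rewrite x0.
Qed.

(** The forms f2, f3 are the coordinates e^2, e^3 after a rotation of <e_2, e_3>,
    which leaves d f2 = - e^1 /\ f3 and d f3 = e^1 /\ f2 unchanged.  The coefficients
    of e 5 and e 6 in the two formulas are tied together by integrability. *)
Lemma g3_frame_intro J (la c s eps t2 t3 u2 u3 q5 q6 : R) :
  (forall X, J (J X) = - X) -> la < 0 -> c ^+ 2 + s ^+ 2 = 1 -> eps ^+ 2 = 1 ->
  q5 ^+ 2 != q6 ^+ 2 ->
  let f2 X := c * e 2 X + s * e 3 X in
  let f3 X := - (s * e 2 X) + c * e 3 X in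
  (forall X, e 1 (J X) = - (eps * e 4 X)) ->
  (forall X, f2 (J X) = la * f2 X + t2 * e 1 X + u2 * e 4 X
    - eps * la * (q6 * e 5 X + q5 * e 6 X)) ->
  (forall X, f3 (J X) = - la^-1 * f3 X + t3 * e 1 X + u3 * e 4 X
    + (q5 * e 5 X + q6 * e 6 X)) ->
  exists w1 w2 w3, g3_frame (- la / 2) J w1 w2 w3.
Proof.
move=> JJ la_neg cs1 eps2 q56 f2 f3 e1J f2J f3J.
have la0 : la != 0 by rewrite lt_eqF.
have eps0 : eps != 0.
  by apply: contra_eq_neq eps2 => ->; rewrite expr0n eq_sym oner_eq0.
(* The multiples of e^1 make w2 and w3 vanish at e_1 - P^-1 t, where t is the
   component of J e_1 in <e_2, e_3>. *)
pose xi2 X := f2 X + la^-1 * t2 * e 1 X.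
pose xi3 X := f3 X - la * t3 * e 1 X.
pose w1 X := e 1 X -i* e 1 (J X).
pose w2 X := xi2 X -i* xi2 (J X).
pose w3 X := xi3 X -i* xi3 (J X).
have xi2J X : xi2 (J X) = la * f2 X + t2 * e 1 X + u2 * e 4 X
    - eps * la * (q6 * e 5 X + q5 * e 6 X) - la^-1 * t2 * eps * e 4 X.
  by rewrite /xi2 f2J e1J; ring.
have xi3J X : xi3 (J X) = - la^-1 * f3 X + t3 * e 1 X + u3 * e 4 X
    + (q5 * e 5 X + q6 * e 6 X) + la * t3 * eps * e 4 X.
  by rewrite /xi3 f3J e1J; ring.
have f2_br X Y : f2 (br X Y) = wedge2 (e 1) f3 X Y.
  by rewrite /f2 e_br2 e_br3 /wedge2 /f3; ring.
have f3_br X Y : f3 (br X Y) = - wedge2 (e 1) f2 X Y.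
  by rewrite /f3 e_br2 e_br3 /wedge2 /f2; ring.
exists w1, w2, w3; split.
- apply: basis10_intro => [j | X wX0].
    elim/forall_I3: j; apply: real_part_form10 => // a X Y.
    + exact: e_lin.
    + by rewrite /xi2 /f2 !e_lin; ring.
    + by rewrite /xi3 /f3 !e_lin; ring.
  have e1X : e 1 X = 0 by have [] := wX0 0.
  have e4X : e 4 X = 0.
    have [_ /eqP] := wX0 0.
    by rewrite e1J opprK mulf_eq0 (negPf eps0) => /eqP.
  have [xi2X /eqP xi2JX] := wX0 1; have [xi3X /eqP xi3JX] := wX0 2%:R.
  have f2X : f2 X = 0 by rewrite -[RHS]xi2X /xi2 e1X; ring.
  have f3X : f3 X = 0 by rewrite -[RHS]xi3X /xi3 e1X; ring.
  rewrite oppr_eq0 xi2J f2X e1X e4X in xi2JX.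
  rewrite oppr_eq0 xi3J f3X e1X e4X in xi3JX.
  have e2X : e 2 X = 0.
    transitivity ((c ^+ 2 + s ^+ 2) * e 2 X); first by rewrite cs1 mul1r.
    by transitivity (c * f2 X - s * f3 X); [rewrite /f2 /f3 | rewrite f2X f3X]; ring.
  have e3X : e 3 X = 0.
    transitivity ((c ^+ 2 + s ^+ 2) * e 3 X); first by rewrite cs1 mul1r.
    by transitivity (s * f2 X + c * f3 X); [rewrite /f2 /f3 | rewrite f2X f3X]; ring.
  have q1 : q6 * e 5 X + q5 * e 6 X = 0.
    apply: (mulfI (mulf_neq0 eps0 la0)); rewrite mulr0.
    by apply: oppr_inj; rewrite oppr0 -[RHS](eqP xi2JX); ring.
  have q2 : q5 * e 5 X + q6 * e 6 X = 0 by rewrite -[RHS](eqP xi3JX); ring.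
  have q56' : q5 ^+ 2 - q6 ^+ 2 != 0 by rewrite subr_eq0.
  have e5X : e 5 X = 0.
    apply: (mulfI q56'); rewrite mulr0.
    by transitivity (q5 * (q5 * e 5 X + q6 * e 6 X)
      - q6 * (q6 * e 5 X + q5 * e 6 X)); [| rewrite q1 q2]; ring.
  have e6X : e 6 X = 0.
    apply: (mulfI q56'); rewrite mulr0.
    by transitivity (q5 * (q6 * e 5 X + q5 * e 6 X)
      - q6 * (q5 * e 5 X + q6 * e 6 X)); [| rewrite q1 q2]; ring.
  by apply: coordP; rewrite ?e1X ?e2X ?e3X ?e4X ?e5X ?e6X /e mxE.
- by move=> X Y; rewrite /w1 e1J e_br1 e_br4 mulr0 !oppr0.
- move=> X Y; rewrite dw2E /=; apply: complex_ext => /=.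
    rewrite /w1 /w2 /w3 /= opprK /xi2 f2_br e_br1 /wedge2 /xi3; ring.
  rewrite /w1 /w2 /w3 /= /wedge2 !xi2J !xi3J !e1J f2_br e_br1 e_br4 e_br5 e_br6.
  rewrite /wedge2 /xi3.
  move: (f2 X) (f2 Y) (f3 X) (f3 Y) => f2X f2Y f3X f3Y.
  by field; rewrite la0.
- have x0 : - la / 2 != 0 by rewrite mulf_neq0 ?oppr_eq0 ?invr_eq0 ?pnatr_eq0.
  move=> X Y; rewrite dw3E //=; apply: complex_ext => /=.
    by rewrite /w1 /w2 /w3 /= /xi3 f3_br e_br1 /wedge2 /xi2; ring.
  rewrite /w1 /w2 /w3 /= /wedge2 !xi2J !xi3J !e1J f3_br e_br1 e_br4 e_br5 e_br6.
  rewrite /wedge2 /xi2.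
  move: (f2 X) (f2 Y) (f3 X) (f3 Y) => f2X f2Y f3X f3Y.
  rewrite -[e 4 X * e 6 Y - _]mul1r -[e 4 X * e 5 Y - _]mul1r -!eps2.
  by field; rewrite la0.
Qed.

End NormalForm.

(** * Classification *)

Section Classification.
Variable R : realType.
Local Notation V := 'rV[R]_6.
Local Notation br := (@g3_bracket R).
Implicit Types (J : 'End(V)) (X Y : V) (x : R).

Lemma g3_structure_classification J : complex_structure br J ->
  has_closed_nonzero_form30 br J -> exists2 x, 0 < x & g3_structure x J.
Proof.
move=> cJ closedJ; have [JJ _] := cJ.
have [[j21 j31 j51 j61] _ [j11 j41 eps2] [j23 detP detQ] [Q1 Q2 _ _]] :=
  complex_structure_coords cJ closedJ.
have [la [c [s [la_neg cs1 eq1 eq2 [eq3 eq4]]]]] := sym_det_N1_diag detP.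
have la0 : la != 0 by rewrite lt_eqF.
exists (- la / 2); first by rewrite divr_gt0 ?oppr_gt0 ?ltr0n.
apply/g3_structureP; split=> //.
pose t2 := c * Jcoef J 1 2 + s * Jcoef J 1 3; pose t3 := - (s * Jcoef J 1 2) + c * Jcoef J 1 3.
pose u2 := c * Jcoef J 4 2 + s * Jcoef J 4 3; pose u3 := - (s * Jcoef J 4 2) + c * Jcoef J 4 3.
pose q5 := - (s * Jcoef J 5 2) + c * Jcoef J 5 3.
pose q6 := - (s * Jcoef J 6 2) + c * Jcoef J 6 3.
have r5 : c * Jcoef J 5 2 + s * Jcoef J 5 3 = - (Jcoef J 1 4 * la * q6).
  transitivity (- la * (- s * (Jcoef J 1 4 * Jcoef J 6 2) + c * (Jcoef J 1 4 * Jcoef J 6 3)));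
    last by rewrite /q6; ring.
  rewrite Q1 Q2; transitivity (- la * (Jcoef J 5 2 * (- (Jcoef J 3 2 * s) + Jcoef J 3 3 * c)
    - Jcoef J 5 3 * (- (Jcoef J 2 2 * s) + Jcoef J 3 2 * c))); last by ring.
  by rewrite eq3 eq4; field.
have r6 : c * Jcoef J 6 2 + s * Jcoef J 6 3 = - (Jcoef J 1 4 * la * q5).
  rewrite -[LHS]mul1r -eps2.
  transitivity (Jcoef J 1 4 * (c * (Jcoef J 1 4 * Jcoef J 6 2) + s * (Jcoef J 1 4 * Jcoef J 6 3)));
    first by ring.
  rewrite Q1 Q2.
  transitivity (Jcoef J 1 4 * (Jcoef J 5 2 * (Jcoef J 3 2 * c + Jcoef J 3 3 * s)
    - Jcoef J 5 3 * (Jcoef J 2 2 * c + Jcoef J 3 2 * s))); first by ring.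
  by rewrite eq1 eq2 /q5; ring.
apply: (g3_frame_intro (c := c) (s := s) (eps := Jcoef J 1 4) (t2 := t2) (t3 := t3)
  (u2 := u2) (u3 := u3) (q5 := q5) (q6 := q6)) => // [|X|X|X].
- apply: contra_neq detQ => q56.
  transitivity ((c ^+ 2 + s ^+ 2) * (Jcoef J 5 2 * Jcoef J 6 3 - Jcoef J 5 3 * Jcoef J 6 2)).
    by rewrite cs1 mul1r.
  transitivity ((c * Jcoef J 5 2 + s * Jcoef J 5 3) * q6
    - (c * Jcoef J 6 2 + s * Jcoef J 6 3) * q5); first by rewrite /q5 /q6; ring.
  rewrite r5 r6; transitivity (Jcoef J 1 4 * la * (q5 ^+ 2 - q6 ^+ 2)); first by ring.
  by rewrite q56 subrr mulr0.
- by rewrite e_lfun -!/(Jcoef _ _ _) j11 j21 j31 j41 j51 j61; ring.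
- rewrite (e_lfun J 2 X) (e_lfun J 3 X) -!/(Jcoef _ _ _) j23.
  transitivity ((Jcoef J 2 2 * c + Jcoef J 3 2 * s) * e 2 X
    + (Jcoef J 3 2 * c + Jcoef J 3 3 * s) * e 3 X + t2 * e 1 X + u2 * e 4 X
    + ((c * Jcoef J 5 2 + s * Jcoef J 5 3) * e 5 X
    + (c * Jcoef J 6 2 + s * Jcoef J 6 3) * e 6 X)); first by rewrite /t2 /u2; ring.
  by rewrite eq1 eq2 r5 r6; ring.
- rewrite (e_lfun J 2 X) (e_lfun J 3 X) -!/(Jcoef _ _ _) j23.
  transitivity ((- (Jcoef J 2 2 * s) + Jcoef J 3 2 * c) * e 2 X
    + (- (Jcoef J 3 2 * s) + Jcoef J 3 3 * c) * e 3 X + t3 * e 1 X + u3 * e 4 X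
    + (q5 * e 5 X + q6 * e 6 X)); first by rewrite /t3 /u3 /q5 /q6; ring.
  by rewrite eq3 eq4; ring.
Qed.

(** The structure J_x in the normal form of [g3_frame_intro] with eps = 1, q5 = 1
    and all the other constants zero; the rows for e 5 and e 6 follow from
    J^2 = -1. *)
Definition g3_model x X : V :=
  let la := - (2 * x) in
  \row_k nth 0 [:: - e 4 X; la * (e 2 X - e 6 X); - la^-1 * e 3 X + e 5 X; e 1 X;
    - (1 + la^-1 ^+ 2) * e 3 X + la^-1 * e 5 X;
    (la + la^-1) * e 2 X - la * e 6 X] k.

Lemma g3_structure_exists x : 0 < x -> exists J, g3_structure x J.
Proof.
move=> x0; set la := - (2 * x).
have la_neg : la < 0 by rewrite oppr_lt0 mulr_gt0 ?ltr0n.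
have la0 : la != 0 by rewrite lt_eqF.
have lin_g : linear (g3_model x).
  move=> a X Y; apply/rowP => k; rewrite !mxE !e_lin.
  by case: k => -[|[|[|[|[|[|k]]]]]] //= _; ring.
have [J JE] := linear_lfun lin_g.
have JX X : [/\ e 1 (J X) = - e 4 X, e 2 (J X) = la * (e 2 X - e 6 X),
    e 3 (J X) = - la^-1 * e 3 X + e 5 X
  & [/\ e 4 (J X) = e 1 X,
    e 5 (J X) = - (1 + la^-1 ^+ 2) * e 3 X + la^-1 * e 5 X
  & e 6 (J X) = (la + la^-1) * e 2 X - la * e 6 X]].
  by rewrite JE /e !mxE !inordK.
have JJ X : J (J X) = - X.
  have eN k : e k (- X) = - e k X by rewrite /e mxE.
  have [E1 E2 E3 [E4 E5 E6]] := JX X.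
  have [F1 F2 F3 [F4 F5 F6]] := JX (J X).
  apply: coordP; rewrite eN ?(F1, F2, F3, F4, F5, F6) ?(E1, E2, E3, E4, E5, E6);
    by [field | ring].
exists J; apply/g3_structureP.
have [w1 [w2 [w3]]] : exists w1 w2 w3, g3_frame (- la / 2) J w1 w2 w3.
  apply: (g3_frame_intro (c := 1) (s := 0) (eps := 1) (t2 := 0) (t3 := 0)
    (u2 := 0) (u3 := 0) (q5 := 1) (q6 := 0)) => // [|||X|X|X].
  - by ring.
  - by ring.
  - by rewrite expr1n expr0n oner_eq0.
  - by have [-> _ _ _] := JX X; ring.
  - by have [_ -> -> _] := JX X; ring.
  - by have [_ -> -> _] := JX X; ring.
have -> : - la / 2 = x by rewrite /la; field.
move=> fw; split; last by exists w1, w2, w3.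
exact: g3_frame_complex_structure fw.
Qed.

End Classification.

Theorem proposition3p4 (R : realType) :
  [/\ (* for every x > 0 the structure equations define a complex structure J_x
         on g_3, unique up to isomorphism, with non-zero closed (3,0)-form *)
      forall x : R, 0 < x -> exists J : 'End('rV[R]_6), g3_structure x J,
      forall (x : R) (J J' : 'End('rV[R]_6)), 0 < x ->
        g3_structure x J -> g3_structure x J' ->
        isomorphic_structures (@g3_bracket R) J J',
      forall (x : R) (J : 'End('rV[R]_6)), 0 < x ->
        g3_structure x J -> has_closed_nonzero_form30 (@g3_bracket R) J,
      (* every complex structure with non-zero closed (3,0)-form is some J_x *)
      forall J : 'End('rV[R]_6),
        complex_structure (@g3_bracket R) J ->
        has_closed_nonzero_form30 (@g3_bracket R) J ->
        exists (x : R) (J' : 'End('rV[R]_6)),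
          [/\ 0 < x, g3_structure x J'
            & isomorphic_structures (@g3_bracket R) J J']
    & (* the structures J_x are pairwise non-isomorphic *)
      forall (x x' : R) (J J' : 'End('rV[R]_6)), 0 < x -> 0 < x' ->
        g3_structure x J -> g3_structure x' J' ->
        isomorphic_structures (@g3_bracket R) J J' -> x = x'].
Proof.
have unique_iso x (J J' : 'End('rV[R]_6)) : g3_structure x J ->
    g3_structure x J' -> isomorphic_structures (@g3_bracket R) J J'.
  move=> /g3_structureP [[JJ _] [w1 [w2 [w3 fw]]]].
  move=> /g3_structureP [[JJ' _] [w1' [w2' [w3' fw']]]].
  exact: g3_frame_isomorphic fw fw'.
split.
- exact: g3_structure_exists.
- by move=> x J J' _; exact: unique_iso.
- move=> x J _ /g3_structureP [[JJ _] [w1 [w2 [w3 fw]]]].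
  exact: g3_frame_closed_form30 fw.
- move=> J cJ closedJ.
  have [x x0 Jx] := g3_structure_classification cJ closedJ.
  by exists x, J; split=> //; exact: (unique_iso x).
- move=> x x' J J' x0 x0' /g3_structureP [[JJ _] [w1 [w2 [w3 fw]]]].
  move=> /g3_structureP [[JJ' _] [w1' [w2' [w3' fw']]]] [F autF FJ].
  have fw'F := g3_frame_pullback JJ' autF FJ fw'.
  exact: g3_frame_parameter_unique fw fw'F.
Qed.
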